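(* Let $\mathbb{F}_q$ be a finite field of characteristic $2$ and let $\mathcal{F}=\mathbb{F}_q(x,y)$ be a cubic function field given in standard form by $y^3-Ay+B=0$ with $A,B\in\mathbb{F}_q[x]$. Let $n_1=\deg(A)$, $n_0=\deg(B)$, and let $a$, $b$ be the leading coefficients of $A$, $B$. Then the signature of $\mathcal{F}/\mathbb{F}_q(x)$ at the infinite place $P_\infty$ is: \begin{itemize} \item $(1,1,1,1,1,1)$ if $3n_1<2n_0$, $n_0\equiv 0 \pmod 3$, $b$ is a cube in $\mathbb{F}_q$ and $q\equiv 1\pmod 3$; or if $3n_1=2n_0$ and $T^3-aT+b$ has three distinct roots in $\mathbb{F}_q$. \item $(1,1,2,1)$ if $3n_1>2n_0$ and $n_1$ is odd. \item $(1,1,1,2)$ if $3n_1<2n_0$, $n_0\equiv 0\pmod 3$, $b$ is a cube in $\mathbb{F}_q$ and $q\equiv -1\pmod 3$; or if $3n_1=2n_0$ and $T^3-aT+b$ has one root in $\mathbb{F}_q$. \item $(3,1)$ if $3n_1<2n_0$ and $n_0\not\equiv 0\pmod 3$. \item $(1,3)$ if $3n_1<2n_0$, $n_0\equiv 0\pmod 3$ and $b$ is not a cube in $\mathbb{F}_q$; or if $3n_1=2n_0$ and $T^3-aT+b$ has no roots in $\mathbb{F}_q$. \end{itemize} (No assertion is made in the case $3n_1>2n_0$ with $n_1$ even.)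
   Context: Cubic function field in standard form: $\mathcal{F}=\mathbb{F}_q(x,y)$ where $x$ is transcendental over $\mathbb{F}_q$, $T^3-A(x)T+B(x)\in\mathbb{F}_q[x][T]$ is irreducible over $\mathbb{F}_q(x)$ with root $y$, at least one of $A,B$ is non-constant, there is no non-constant $Q\in\mathbb{F}_q[x]$ with $Q^2\mid A$ and $Q^3\mid B$, and $\mathbb{F}_q$ is algebraically closed in $\mathcal{F}$. Convention: $\deg(0)=-\infty$. The infinite place $P_\infty$ of $\mathbb{F}_q(x)$ is the one with valuation $v_{P_\infty}(G)=-\deg(G)$ for polynomials $G$. The signature of $\mathcal{F}/\mathbb{F}_q(x)$ at a place $P$ of $\mathbb{F}_q(x)$ is the list of pairs $(e(P_i|P),f(P_i|P))$ of ramification indices and relative (residue) degrees of all places $P_1,\dots,P_m$ of $\mathcal{F}$ above $P$, written as one tuple and ordered lexicographically; e.g. $(1,1,2,1)$ means two places, one with $e=f=1$ and one with $e=2$, $f=1$. *)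

(* Defs.v *)
From mathcomp Require Import all_boot all_order all_algebra all_field.
From mathcomp Require Import finmap boolp classical_sets cardinality.
From mathcomp Require Import constructive_ereal.

Set Implicit Arguments.
Unset Strict Implicit.
Unset Printing Implicit Defensive.

Import Order.TTheory GRing.Theory Num.Theory.

Local Open Scope classical_set_scope.
Local Open Scope ring_scope.

(* deg 0 = -oo; for p != 0 the degree is recovered as an integer by [fine]. *)
Definition deg (R : nzRingType) (p : {poly R}) : \bar int :=
  if p == 0 then -oo%E else ((size p).-1%:Z)%:E.

Notation ratfun k := {fraction {poly k}}.

(* [iota] is the embedding of the constant field [k] into [L]. *)
Section Places.
Variables (k : Type) (L : fieldType) (iota : k -> L).
Implicit Types (O P : set L).

Record valuation_ring O : Prop := ValuationRing {
  valuation_ring_const : forall c : k, O (iota c);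
  valuation_ring_sub : forall u v : L, O u -> O v -> O (u - v);
  valuation_ring_mul : forall u v : L, O u -> O v -> O (u * v);
  valuation_ring_proper : exists z : L, ~ O z;
  valuation_ring_inv : forall z : L, O z \/ O z^-1 }.

Definition units_of O : set L := [set u | [/\ u != 0, O u & O u^-1]].

(* A valuation ring is a local ring, whose maximal ideal is the set of its
   non-units. *)
Definition place P : Prop :=
  exists2 O, valuation_ring O & P = O `\` units_of O.

(* The valuation ring O_P of a place P. The disjunct z = 0 is needed because
   0^-1 = 0 lies in P. *)
Definition place_ring P : set L := [set z | z = 0 \/ ~ P z^-1].

Definition prime_element P (t : L) : Prop :=
  P = [set t * u | u in place_ring P].

(* The normalized discrete valuation v_P; v_P(0) takes the dummy value 0. *)
Definition place_val P (z : L) : int :=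
  xget 0 [set n : int | exists t u : L,
    [/\ prime_element P t, units_of (place_ring P) u & z = t ^ n * u]].

End Places.

Section Signature.
Variables (k : Type) (K : fieldType) (iota : k -> K) (L : fieldExtType K).
Implicit Types (P : set K) (Q : set L).

Definition places_above P : set (set L) :=
  [set Q | place (fun c => (iota c)%:A : L) Q /\
           (forall z : K, P z -> Q z%:A)].

Definition ramification_index P Q : nat :=
  xget 0%N [set e : nat | (0 < e)%N /\
    forall z : K, z != 0 -> place_val Q z%:A = e%:Z * place_val P z].

(* The classes modulo Q of the b_i form a basis of the residue field O_Q / Q
   over the residue field O_P / P. *)
Definition residue_basis P Q (f : nat) (b : 'I_f -> L) : Prop :=
  [/\ forall i, place_ring Q (b i),
      forall c : 'I_f -> K, (forall i, place_ring P (c i)) ->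
        Q (\sum_i c i *: b i) -> forall i, P (c i)
    & forall z : L, place_ring Q z ->
        exists2 c : 'I_f -> K, forall i, place_ring P (c i)
                             & Q (z - \sum_i c i *: b i)].

Definition relative_degree P Q : nat :=
  xget 0%N [set f : nat | exists b : 'I_f -> L, residue_basis P Q b].

(* [fset_set] enumerates the places above P, and would yield the empty
   sequence if there were infinitely many of them. *)
Definition signature P : seq nat :=
  flatten [seq [:: ef.1; ef.2] | ef <-
    sort (fun s t : nat *l nat => (s <= t)%O)
      [seq (ramification_index P Q, relative_degree P Q)
      | Q <- enum_fset (fset_set (places_above P))]].

End Signature.

Definition cst_ratfun (k : fieldType) (c : k) : ratfun k := tofrac c%:P.

(* The place with valuation v(g / h) = deg h - deg g. *)
Definition infinite_place (k : fieldType) : set (ratfun k) :=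
  [set z | exists g h : {poly k},
    [/\ h != 0, z = tofrac g / tofrac h & (deg g < deg h)%E]].

(* T^3 - aT + b *)
Definition cubic (R : nzRingType) (a b : R) : {poly R} :=
  'X^3 - a *: 'X + b%:P.

(* F = k(x, y), where x is 'X; the root y satisfies y^3 - A y + B = 0. *)
Record standard_form (k : fieldType) (F : fieldExtType (ratfun k))
    (A B : {poly k}) (y : F) : Prop := StandardForm {
  standard_irreducible : irreducible_poly (cubic (tofrac A) (tofrac B));
  standard_root : root (map_poly (in_alg F) (cubic (tofrac A) (tofrac B))) y;
  standard_gen : <<1%VS; y>>%VS = fullv;
  standard_nonconst : (0 < deg A)%E \/ (0 < deg B)%E;
  standard_minimal : forall Q : {poly k},
    Q ^+ 2 %| A -> Q ^+ 3 %| B -> (deg Q <= 0)%E;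
  standard_constants : forall z : F,
    algebraicOver (fun c : k => (cst_ratfun c)%:A : F) z ->
    exists c : k, z = (cst_ratfun c)%:A }.

(* Main.v *)
Require Import Defs.
From mathcomp Require Import all_boot all_order all_algebra all_field.
From mathcomp Require Import finmap boolp classical_sets cardinality.
From mathcomp Require Import constructive_ereal ring zify.

(** Put pi = 1/x, a uniformizer at infinity. Everything is read off from an
    equation Phi(theta) = 0, where theta generates F and Phi is monic of degree
    [F : K] with coefficients in k[pi]. Let R = k[pi][theta] and let G be an
    irreducible factor of multiplicity e of Phi modulo pi. If the prime
    (pi, G(theta)) of R is locally principal, then the localization of R there
    is a discrete valuation ring of ramification index e and residue field
    k[T]/(G) ([local_ring_spec], [residue_basis_at]). There are no other places
    above infinity: a valuation ring of F above infinity contains R, because it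
    is integrally closed; its maximal ideal contains G(theta) for one of the
    factors G; and a discrete valuation ring is a maximal subring
    ([dvr_maximal], [places_above_inf]). Hence the signature is the list of the
    pairs (e, deg G) ([signature_inf]).

    The prime is locally principal when e = 1, a generator being pi, and, by
    Dedekind's criterion, when Phi = G^e H + pi S with H and S prime to G modulo
    pi, a generator being G(theta) ([local_uniformizer]).

    It remains to choose theta. Let n1 = deg A and n0 = deg B.
    - If 3 n1 <= 2 n0 and n0 = 3 m, take theta = y / x^m. The reduction of Phi is
      T^3 - a' T + b, where a' is a or 0 according as 3 n1 = 2 n0 or not. In
      characteristic 2 a double root t would satisfy t^2 = a', hence b = 0, so
      the reduction is squarefree and its number of roots decides the signature.
      When a' = 0 the roots are the cube roots of b, whose number depends on
      q modulo 3.
    - If 3 n1 < 2 n0 and 3 does not divide n0, then y / x^(m+1) (n0 = 3 m + 2)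
      or a multiple of the inverse of y / x^m (n0 = 3 m + 1) has an Eisenstein
      equation, with reduction T^3 ([signature_total1], [signature_total2]).
    - If 3 n1 > 2 n0 and n1 = 2 m + 1, then w = y / x^m satisfies
      pi w^3 - a0 w + b0 = 0 with a0(0) = a. On the projective line over k this
      equation has a simple root and, at infinity, a double one. A Moebius
      transformation moving another point to infinity makes the equation monic,
      with reduction T^2 (T - a), and the double root satisfies Dedekind's
      criterion ([moebius_cubic], [signature_partial]). *)

Set Implicit Arguments.
Unset Strict Implicit.
Unset Printing Implicit Defensive.

Import Order.TTheory GRing.Theory Num.Theory.
Import Pdiv.CommonRing Pdiv.RingMonic.

Local Open Scope ring_scope.

(** * Valuation rings and discrete valuation rings *)

Section Dvr.
Variables (k : Type) (L : fieldType) (iota : k -> L).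
Implicit Types (O P Q : set L) (t u z : L).

Definition max_ideal O : set L := (O `\` units_of O)%classic.

Section ValuationRing.
Variable O : set L.
Hypothesis HO : valuation_ring iota O.

Lemma vring0 : O 0.
Proof.
have [/= z _] := valuation_ring_proper HO.
have zz w : O w -> O 0 by move=> Ow; rewrite -(subrr w); apply: (valuation_ring_sub HO).
by have [] := valuation_ring_inv HO z => /zz.
Qed.

Lemma vringN z : O z -> O (- z).
Proof. by move=> Hz; rewrite -sub0r; apply: (valuation_ring_sub HO) Hz; apply: vring0. Qed.

Lemma vringD z w : O z -> O w -> O (z + w).
Proof. by move=> Hz Hw; rewrite -[w]opprK; apply: (valuation_ring_sub HO) => //; apply: vringN. Qed.

Lemma vring1 : O 1.
Proof. by have [] := valuation_ring_inv HO 1 => //; rewrite invr1. Qed.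

Lemma vringX z n : O z -> O (z ^+ n).
Proof.
move=> Hz; elim: n => [|n IH]; first by rewrite expr0; apply: vring1.
by rewrite exprS; apply: (valuation_ring_mul HO).
Qed.

Lemma vring_sum (I : Type) (r : seq I) (p : pred I) (f : I -> L) :
  (forall i, p i -> O (f i)) -> O (\sum_(i <- r | p i) f i).
Proof. by move=> Hf; apply: (big_ind O); [apply: vring0|exact: vringD|]. Qed.

Lemma max_idealP z : max_ideal O z <-> z = 0 \/ ~ O z^-1.
Proof.
split=> [[Hz Nz]|].
  have [->|z0] := eqVneq z 0; [by left|right=> Hi; apply: Nz].
  by split.
case=> [->|Hz].
  by split; [apply: vring0|case; rewrite eqxx].
split; first by have [] := valuation_ring_inv HO z.
by case.
Qed.

Lemma place_ringE : place_ring (max_ideal O) = O.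
Proof.
apply/seteqP; split => z /=.
  case=> [->|Hz]; first exact: vring0.
  by apply: contrapT => NOz; apply: Hz; apply/max_idealP; right; rewrite invrK.
move=> Oz; have [->|z0] := eqVneq z 0; [by left|right=> /max_idealP].
by rewrite invrK => -[/eqP|//]; rewrite invr_eq0 (negPf z0).
Qed.

Lemma max_ideal0 : max_ideal O 0.
Proof. by apply/max_idealP; left. Qed.

Lemma max_ideal1 : ~ max_ideal O 1.
Proof. by case/max_idealP => [/eqP|]; rewrite ?oner_eq0 // invr1 => H; apply/H/vring1. Qed.

Lemma max_idealMl z w : O z -> max_ideal O w -> max_ideal O (z * w).
Proof.
move=> Oz /max_idealP[->|Hw]; first by rewrite mulr0; apply: max_ideal0.
have [->|z0] := eqVneq z 0; first by rewrite mul0r; apply: max_ideal0.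
apply/max_idealP; right => H; apply: Hw.
by rewrite -(mulKf z0 w) invfM invrK; apply: (valuation_ring_mul HO).
Qed.

Lemma max_idealMr z w : O w -> max_ideal O z -> max_ideal O (z * w).
Proof. by rewrite mulrC; apply: max_idealMl. Qed.

Lemma max_idealD z w : max_ideal O z -> max_ideal O w -> max_ideal O (z + w).
Proof.
have [->|z0] := eqVneq z 0; first by rewrite add0r.
have [->|w0] := eqVneq w 0; first by rewrite addr0.
move=> Mz Mw; have [H|H] := valuation_ring_inv HO (z / w).
  have -> : z + w = (z / w + 1) * w by rewrite mulrDl divfK // mul1r.
  by apply: max_idealMl => //; apply: vringD H vring1.
have -> : z + w = (w / z + 1) * z by rewrite mulrDl divfK // mul1r addrC.
by apply: max_idealMl => //; apply: vringD vring1; rewrite -[w / z]invrK invf_div.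
Qed.

Lemma max_idealN z : max_ideal O z -> max_ideal O (- z).
Proof. by rewrite -mulN1r; apply: max_idealMl; apply/vringN/vring1. Qed.

Lemma max_idealB z w : max_ideal O z -> max_ideal O w -> max_ideal O (z - w).
Proof. by move=> Hz Hw; apply: max_idealD => //; apply: max_idealN. Qed.

Lemma max_ideal_sum (I : Type) (r : seq I) (p : pred I) (f : I -> L) :
  (forall i, p i -> max_ideal O (f i)) -> max_ideal O (\sum_(i <- r | p i) f i).
Proof. by move=> Hf; apply: (big_ind (max_ideal O)); [apply: max_ideal0|exact: max_idealD|]. Qed.

Lemma max_ideal_prime z w : O z -> O w ->
  max_ideal O (z * w) -> max_ideal O z \/ max_ideal O w.
Proof.
move=> Oz Ow Hzw; have [|Nz] := pselect (max_ideal O z); [by left|right].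
apply: contrapT => Nw; case: Hzw => _; apply.
have [Uz Uw] : units_of O z /\ units_of O w by split; apply: contrapT => H; [apply: Nz|apply: Nw].
case: Uz Uw => z0 _ Iz [w0 _ Iw]; split; first by rewrite mulf_neq0.
  exact: (valuation_ring_mul HO).
by rewrite invfM; apply: (valuation_ring_mul HO).
Qed.

Lemma max_ideal_prime_prod (I : eqType) (r : seq I) (f : I -> L) :
  (forall i, O (f i)) -> max_ideal O (\prod_(i <- r) f i) ->
  exists2 i, i \in r & max_ideal O (f i).
Proof.
move=> Of; elim: r => [|i r IH]; first by rewrite big_nil => /max_ideal1.
have Oprod : O (\prod_(j <- r) f j).
  by apply: (big_ind O) => //; [apply: vring1|exact: (valuation_ring_mul HO)].
rewrite big_cons => /max_ideal_prime [] //.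
  by exists i; rewrite ?mem_head.
by case/IH => j jr Mj; exists j; rewrite ?in_cons ?jr ?orbT.
Qed.

Lemma max_ideal_primeX z n : O z -> max_ideal O (z ^+ n) -> max_ideal O z.
Proof.
move=> Oz; elim: n => [/max_ideal1//|n IH].
by rewrite exprS => /max_ideal_prime [] //; exact: vringX.
Qed.

Lemma unit_notin_max_ideal z : O z -> ~ max_ideal O z -> units_of O z.
Proof. by move=> Oz Nz; apply: contrapT => H; apply: Nz. Qed.

(** Otherwise 1/z lies in O, and the equation divided by a power of z exhibits z
    as a polynomial in 1/z with coefficients in O. *)
Lemma vring_integral (p : {poly L}) z :
  p \is monic -> (forall i, O p`_i) -> root p z -> O z.
Proof.
move=> pm Op /rootP pz; apply: contrapT => Nz.
have Oi : O z^-1 by have [] := valuation_ring_inv HO z.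
have z0 : z != 0 by apply/eqP => z0; apply: Nz; rewrite z0; apply: vring0.
have [n sp] : exists n, size p = n.+2.
  case E: (size p) => [|[|n]]; last by exists n.
    by move: (monic_neq0 pm); rewrite -size_poly_eq0 E.
  have /size_poly1P[c c0 pc] : size p == 1%N by rewrite E.
  by move: pz c0; rewrite pc hornerC => ->; rewrite eqxx.
move: pz; rewrite horner_coef sp big_ord_recr /=.
have -> : p`_n.+1 = 1 by move/monicP: pm; rewrite lead_coefE sp.
rewrite mul1r exprS => /eqP; rewrite addrC addr_eq0 => /eqP H.
apply: Nz; have -> : z = - \sum_(i < n.+1) p`_i * z^-1 ^+ (n - i).
  apply: (mulIf (expf_neq0 n z0)); rewrite H mulNr; congr (- _).
  rewrite mulr_suml; apply: eq_bigr => i _; rewrite -mulrA; congr (_ * _).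
  have li : (i <= n)%N by rewrite -ltnS.
  have -> : z ^+ n = z ^+ (n - i) * z ^+ i by rewrite -exprD subnK.
  by rewrite mulrA -exprMn mulVf // expr1n mul1r.
apply/vringN/vring_sum => i _; apply: (valuation_ring_mul HO) => //.
exact: vringX.
Qed.

End ValuationRing.

(** The factorization axiom replaces a valuation: n is the valuation of z. *)
Record dvr O t : Prop := Dvr {
  dvr_const : forall c : k, O (iota c);
  dvr_sub : forall u v : L, O u -> O v -> O (u - v);
  dvr_mul : forall u v : L, O u -> O v -> O (u * v);
  dvr_uniformizer : O t;
  dvr_noninv : ~ O t^-1;
  dvr_fact : forall z, z != 0 -> exists (n : int) u, units_of O u /\ z = t ^ n * u }.

Section DvrTheory.
Variables (O : set L) (t : L).
Hypothesis Ot : dvr O t.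

Lemma dvr1 : O 1.
Proof. by have [n [u [[u0 Hu Hi] _]]] := dvr_fact Ot (oner_neq0 _); rewrite -(divff u0); apply: dvr_mul Ot _ _ Hu Hi. Qed.

Lemma dvrX z n : O z -> O (z ^+ n).
Proof.
move=> Hz; elim: n => [|n IH]; first by rewrite expr0; apply: dvr1.
by rewrite exprS; apply: (dvr_mul Ot).
Qed.

Lemma dvr_valuation_ring : valuation_ring iota O.
Proof.
split; [exact: dvr_const Ot|exact: dvr_sub Ot|exact: dvr_mul Ot| |].
  by exists t^-1; apply: dvr_noninv Ot.
move=> z; have [->|z0] := eqVneq z 0.
  by left; rewrite -(subrr t); apply: (dvr_sub Ot); apply: dvr_uniformizer Ot.
have [n [u [[u0 Ou Oi] ->]]] := dvr_fact Ot z0.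
have tX m : O (t ^+ m) by apply: dvrX; apply: dvr_uniformizer Ot.
case: n => n; first by left; apply: (dvr_mul Ot) => //; apply: tX.
right.
by rewrite NegzE -exprnN invfM invrK; apply: (dvr_mul Ot).
Qed.
Let HO := dvr_valuation_ring.

Lemma dvr_neq0 : t != 0.
Proof. by apply/eqP => t0; apply: (dvr_noninv Ot); rewrite t0 invr0 -t0; apply: dvr_uniformizer Ot. Qed.

Lemma dvr_max_ideal : max_ideal O t.
Proof. by apply/(max_idealP HO); right; apply: dvr_noninv Ot. Qed.

Lemma dvr_max_idealE z : max_ideal O z <-> exists2 u, O u & z = t * u.
Proof.
split; last by case=> u Ou ->; apply: (max_idealMr HO) => //; exact: dvr_max_ideal.
move=> Mz; have [->|z0] := eqVneq z 0.
  by exists 0; rewrite ?mulr0 //; apply: (vring0 HO).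
have [[[|n]|n] [u [[u0 Ou Oi] zE]]] := dvr_fact Ot z0.
- by case: Mz => _ []; split=> //; rewrite zE expr0z mul1r.
- exists (t ^+ n * u); last by rewrite zE mulrA -exprS.
  by apply: (dvr_mul Ot) => //; apply/dvrX/(dvr_uniformizer Ot).
exfalso; case/(max_idealP HO): Mz => [z00|]; first by rewrite z00 eqxx in z0.
apply; rewrite zE NegzE -exprnN invfM invrK.
by apply: (dvr_mul Ot) => //; apply/dvrX/(dvr_uniformizer Ot).
Qed.

Lemma dvr_place : place iota (max_ideal O).
Proof. by exists O => //; exact: HO. Qed.

Lemma dvr_prime_element : prime_element (max_ideal O) t.
Proof.
rewrite /prime_element (place_ringE HO); apply/seteqP; split=> z.
  by case/dvr_max_idealE => u Ou ->; exists u.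
by case=> u Ou <-; apply/dvr_max_idealE; exists u.
Qed.

Lemma units_ofM u v : units_of O u -> units_of O v -> units_of O (u * v).
Proof.
by case=> u0 Ou Iu [v0 Ov Iv]; split; rewrite ?mulf_neq0 ?invfM //; apply: (dvr_mul Ot).
Qed.

Lemma units_ofV u : units_of O u -> units_of O u^-1.
Proof. by case=> u0 Ou Iu; split; rewrite ?invr_eq0 ?invrK. Qed.

Lemma units_of1 : units_of O 1.
Proof. by split; rewrite ?oner_neq0 ?invr1 //; apply: dvr1. Qed.

Lemma units_ofX u n : units_of O u -> units_of O (u ^+ n).
Proof.
move=> Hu; elim: n => [|n IH]; first exact: units_of1.
by rewrite exprS; apply: units_ofM.
Qed.

Lemma units_ofXz u (n : int) : units_of O u -> units_of O (u ^ n).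
Proof.
by case: n => n Hu; [exact: units_ofX|apply/units_ofV/units_ofX].
Qed.

Lemma dvr_expz_unit (n : int) : units_of O (t ^ n) -> n = 0.
Proof.
have tS m : ~ O (t ^+ m.+1)^-1.
  move=> H; apply: (dvr_noninv Ot).
  have -> : t^-1 = t ^+ m * (t ^+ m.+1)^-1.
    by rewrite exprS invfM [t^-1 * _]mulrC mulVKf // expf_neq0 // dvr_neq0.
  by apply: (dvr_mul Ot) => //; apply/dvrX/(dvr_uniformizer Ot).
by case: n => [[|n]|n] // [_ H1 H2]; case: (tS n).
Qed.

(** Two prime elements differ by a unit, so any choice of t in [place_val] yields
    the same exponent. *)
Lemma place_valE (n : int) u : units_of O u -> place_val (max_ideal O) (t ^ n * u) = n.
Proof.
move=> Uu; rewrite /place_val; case: xgetP => [m _ /= [t' [u' [Pt']]]|/(_ n)]; last first.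
  by case; exists t, u; split=> //; rewrite ?(place_ringE HO) //; exact: dvr_prime_element.
rewrite (place_ringE HO) => Uu' E.
have [v Uv t'E] : exists2 v, units_of O v & t' = t * v.
  have Mt' : max_ideal O t'.
    rewrite Pt'; exists 1; rewrite ?mulr1 // (place_ringE HO); exact: (vring1 HO).
  have [v Ov t'E] := (dvr_max_idealE _).1 Mt'; exists v => //.
  have := dvr_max_ideal; rewrite {1}Pt' (place_ringE HO) => -[w Ow tE].
  have vw1 : v * w = 1.
    by apply: (mulfI dvr_neq0); rewrite mulrA -t'E tE mulr1.
  have v0 : v != 0 by apply: contra_eq_neq vw1 => ->; rewrite mul0r eq_sym oner_eq0.
  by split=> //; rewrite -[v^-1]mulr1 -vw1 mulKf.
have t0 := dvr_neq0.
have/eqP : t ^ (n - m) = v ^ m * u' * u^-1.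
  apply: (mulfI (expfz_neq0 m t0)); rewrite -expfzDr // addrC subrK.
  case: (Uu) => u0 _ _; apply: (mulIf u0).
  by rewrite E t'E expfzMl !mulrA divfK.
move/eqP => E2; have : units_of O (t ^ (n - m)).
  rewrite E2; apply: units_ofM; last exact: units_ofV.
  by apply: units_ofM => //; apply: units_ofXz.
by move/dvr_expz_unit => /eqP; rewrite subr_eq0 => /eqP.
Qed.

End DvrTheory.

(** If z lies in V but not in O, then 1/z is a multiple of t in O, hence a non-unit
    of V; but z * (1/z) = 1. *)
Lemma dvr_maximal O t V : dvr O t -> valuation_ring iota V ->
  (forall z, O z -> V z) -> max_ideal V t -> V = O.
Proof.
move=> Ot HV OV Vt; have HO := dvr_valuation_ring Ot.
apply/seteqP; split=> z; last exact: OV.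
move=> Vz; apply: contrapT => Nz.
have z0 : z != 0 by apply/eqP => z0; apply: Nz; rewrite z0; apply: (vring0 HO).
have Mi : max_ideal O z^-1 by apply/(max_idealP HO); right; rewrite invrK.
have [u Ou zE] := (dvr_max_idealE Ot _).1 Mi.
apply: (max_ideal1 HV); rewrite -(mulfV z0) zE.
by apply: (max_idealMl HV) => //; apply: (max_idealMr HV) => //; apply: OV.
Qed.

Lemma placeP Q : place iota Q ->
  exists2 O, valuation_ring iota O & Q = max_ideal O.
Proof. by []. Qed.

End Dvr.

(** * Localization at a locally principal prime *)

Section Localization.
Variables (k : Type) (L : fieldType) (iota : k -> L).
Variables (E : comNzRingType) (ev : {rmorphism E -> L}) (M : pred E) (t : E).

(** The localization at M of the image of E. Describing it by fractions of images
    spares the construction of that image as a ring. *)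
Definition localization : set L :=
  [set z | exists p s, ~~ M s /\ z = ev p / ev s]%classic.

Hypothesis ev_const : forall c, exists p, iota c = ev p.
Hypothesis ev_frac : forall z, exists p d, ev d != 0 /\ z = ev p / ev d.
Hypothesis M_ker : forall p, ev p = 0 -> M p.
Hypothesis M_sub : forall p q, M p -> M q -> M (p - q).
Hypothesis M_prime : forall p q, M (p * q) = M p || M q.
Hypothesis M_1 : ~~ M 1.
Hypothesis M_t : M t.
Hypothesis t_neq0 : ev t != 0.
(* M is generated by t after localization, and every nonzero element of the image
   of E divides, up to a factor outside M, a power of t. *)
Hypothesis M_gen : forall p, M p -> exists s q, ~~ M s /\ ev (s * p) = ev (t * q).
Hypothesis M_dvd : forall p, ev p != 0 ->
  exists n q s, ~~ M s /\ ev (p * q) = ev (t ^+ n * s).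

Let M_ev p q : ev p = ev q -> M p = M q.
Proof.
have H a b : ev a = ev b -> M a -> M b.
  move=> Eab Ma; rewrite -[b](subKr a); apply: M_sub => //.
  by apply: M_ker; rewrite rmorphB Eab subrr.
by move=> Epq; apply/idP/idP; apply: H.
Qed.

Let ev_neq0 s : ~~ M s -> ev s != 0.
Proof. by apply: contraNneq => /M_ker. Qed.

Let M_nmul p q : ~~ M p -> ~~ M q -> ~~ M (p * q).
Proof. by rewrite M_prime negb_or => -> ->. Qed.

Lemma localization_ev p : localization (ev p).
Proof. by exists p, 1; rewrite rmorph1 divr1. Qed.

Lemma localization_units p s : ~~ M p -> ~~ M s -> units_of localization (ev p / ev s).
Proof.
move=> Mp Ms; split; first by rewrite mulf_neq0 ?invr_eq0 ?ev_neq0.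
  by exists p, s.
by exists s, p; rewrite invf_div.
Qed.

(** Factors t can be split off from p as long as the cofactor stays in M. This stops
    because p divides t^m up to a factor outside M. *)
Lemma localization_fact p : ev p != 0 ->
  exists n u s, [/\ ~~ M u, ~~ M s & ev (s * p) = ev (t ^+ n * u)].
Proof.
move=> p0; have [m [q [s0 [Ms0 Epq]]]] := M_dvd p0.
elim: m p s0 p0 Ms0 Epq => [|m IH] p s0 p0 Ms0 Epq.
  exists 0%N, p, 1; split=> //.
  by apply: contra Ms0 => Mp; rewrite -[s0]mul1r -(M_ev Epq) M_prime Mp.
have [Mp|Mp] := boolP (M p); last first.
  by exists 0%N, p, 1; split.
have [s [p' [Ms Esp]]] := M_gen Mp.
have tp' : ev (t * p') != 0.
  by rewrite -Esp rmorphM mulf_neq0 ?(ev_neq0 Ms).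
have [t0 p'0] : ev t != 0 /\ ev p' != 0.
  by apply/andP; rewrite -negb_or -mulf_eq0 -rmorphM.
have [||n [u [s' [Mu Ms' E']]]] := IH p' (s0 * s) p'0; first exact: M_nmul.
  apply: (mulfI t0); rewrite -!rmorphM /= [t * (p' * q)]mulrA rmorphM -Esp -rmorphM.
  rewrite -mulrA rmorphM Epq -rmorphM exprS; congr (ev _).
  by rewrite mulrC -!mulrA.
exists n.+1, u, (s * s'); split=> //; first exact: M_nmul.
have -> : s * s' * p = s * p * s' by rewrite mulrAC.
rewrite [LHS]rmorphM Esp -rmorphM -mulrA [p' * _]mulrC [LHS]rmorphM E' -rmorphM.
by rewrite exprS mulrA.
Qed.

Lemma localization_dvr : dvr iota localization (ev t).
Proof.
split.
- by move=> c; have [p ->] := ev_const c; apply: localization_ev.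
- move=> _ _ [p [s [Ms ->]]] [q [s' [Ms' ->]]].
  exists (p * s' - q * s), (s * s'); split; first exact: M_nmul.
  by rewrite -mulNr addf_div ?ev_neq0 // rmorphB !rmorphM mulNr.
- move=> _ _ [p [s [Ms ->]]] [q [s' [Ms' ->]]].
  exists (p * q), (s * s'); split; first exact: M_nmul.
  by rewrite !rmorphM mulf_div.
- exact: localization_ev.
- case=> p [s [Ms Et]].
  have s0 := ev_neq0 Ms; case/negP: Ms; suff /M_ev-> : ev s = ev (t * p) by rewrite M_prime M_t.
  by rewrite rmorphM -[ev p](divfK s0) -Et mulrA mulfV // mul1r.
move=> z; have [p [d [d0 ->]]] := ev_frac z.
rewrite mulf_eq0 invr_eq0 (negPf d0) orbF => p0.
have [n [u [s [Mu Ms Ep]]]] := localization_fact p0.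
have [m [v [s' [Mv Ms' Ed]]]] := localization_fact d0.
exists (n%:Z - m%:Z), (ev (u * s') / ev (s * v)); split.
  by apply: localization_units; apply: M_nmul.
have -> : ev p = ev t ^+ n * ev u / ev s.
  by rewrite -rmorphXn -rmorphM -Ep rmorphM mulrAC mulfV ?ev_neq0 // mul1r.
have -> : ev d = ev t ^+ m * ev v / ev s'.
  by rewrite -rmorphXn -rmorphM -Ed rmorphM mulrAC mulfV ?ev_neq0 // mul1r.
have := (ev_neq0 Ms, ev_neq0 Ms', ev_neq0 Mv, expf_neq0 m t_neq0).
rewrite expfzDr // -exprnP -exprnN !rmorphM.
by move: (ev t ^+ n) (ev t ^+ m) => x y' [[[? ?] ?] ?]; field; apply/and4P.
Qed.

Let HO := dvr_valuation_ring localization_dvr.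

Lemma localization_max_ideal p : max_ideal localization (ev p) <-> M p.
Proof.
split=> [Mp|Mp].
  apply/negPn/negP => Np; case: Mp => _ [].
  by rewrite -[ev p]divr1 -(rmorph1 ev); apply: localization_units.
have [s [q [Ms Esp]]] := M_gen Mp.
apply/(dvr_max_idealE localization_dvr); exists (ev q / ev s).
  by exists q, s.
by rewrite mulrA -rmorphM -Esp rmorphM mulrAC mulfV ?ev_neq0 // mul1r.
Qed.

(** The elements of E outside M become units in V, so V contains the localization,
    which is a maximal subring. *)
Lemma localization_unique V : valuation_ring iota V ->
  (forall p, V (ev p)) -> (forall p, max_ideal V (ev p) <-> M p) ->
  V = localization.
Proof.
move=> HV VE VM; apply: (dvr_maximal localization_dvr HV); last exact/VM.
move=> _ [p [s [Ms ->]]]; apply: (valuation_ring_mul HV) => //.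
by have [|] := unit_notin_max_ideal (VE s) => //; move/VM; apply/negP.
Qed.

End Localization.

(** * Relative degree and ramification index *)

Section RelativeDegree.
Variables (k : fieldType) (K : fieldType) (iota : {rmorphism k -> K}) (L : fieldExtType K).
Variables (OP : set K) (OQ : set L).
Hypothesis HP : valuation_ring iota OP.
Hypothesis HQ : valuation_ring (fun c => (iota c)%:A : L) OQ.
Local Notation P := (max_ideal OP).
Local Notation Q := (max_ideal OQ).
(* P has residue field k: residue bases can be tested on constants. *)
Hypothesis P_deg1 : forall z, OP z -> exists c, P (z - iota c).
Hypothesis PQ : forall z, P z -> Q z%:A.

Let in_algZ (a : K) (v : L) : a *: v = a%:A * v.
Proof. by rewrite mulr_algl. Qed.

Lemma residue_const z : P (iota z) -> z = 0.
Proof.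
move=> Pz; apply/eqP/negPn/negP => z0; apply: (max_ideal1 HP).
have iz0 : iota z != 0 by rewrite fmorph_eq0.
rewrite -(mulVf iz0) -fmorphV.
by apply: (max_idealMl HP) => //; apply: (valuation_ring_const HP).
Qed.

Lemma above_ring z : OP z -> OQ z%:A.
Proof.
move=> /P_deg1[c Pc]; rewrite -(subrK (iota c) z) scalerDl.
apply: (vringD HQ); last exact: (valuation_ring_const HQ c).
by have [] := PQ Pc.
Qed.

Lemma residue_basis_const f (b : 'I_f -> L) : residue_basis P Q b ->
  (forall g : 'I_f -> k, Q (\sum_i iota (g i) *: b i) -> forall i, g i = 0) /\
  (forall z, OQ z -> exists g : 'I_f -> k, Q (z - \sum_i iota (g i) *: b i)).
Proof.
case; rewrite (place_ringE HP) (place_ringE HQ) => Ob bfree bgen; split.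
  move=> g Qg i; apply: residue_const; apply: bfree Qg i => i.
  exact: (valuation_ring_const HP).
move=> z /bgen[c Oc Qz].
have /choice[g Hg] : forall i, exists x : k, P (c i - iota x) by move=> i; apply: P_deg1.
exists g; rewrite -(subrK (\sum_i c i *: b i) z) -addrA; apply: (max_idealD HQ) => //.
rewrite -sumrB; apply: (max_ideal_sum HQ) => i _.
by rewrite -scalerBl in_algZ; apply: (max_idealMr HQ); [apply: Ob|apply: PQ].
Qed.

(** Expressing each family in terms of the other modulo Q gives matrices over k
    with A *m B = 1, so that A has at most as many rows as columns. *)
Lemma residue_basis_leq f f' (b : 'I_f -> L) (b' : 'I_f' -> L) :
  residue_basis P Q b -> residue_basis P Q b' -> (f <= f')%N.
Proof.
move=> Hb Hb'; have [bfree bgen] := residue_basis_const Hb.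
have [_ b'gen] := residue_basis_const Hb'.
have Ob i : OQ (b i) by case: Hb => Ob _ _; rewrite -(place_ringE HQ).
have Ob' i : OQ (b' i) by case: Hb' => Ob' _ _; rewrite -(place_ringE HQ).
have /choice[N HN] : forall i, exists g : 'I_f' -> k, Q (b i - \sum_j iota (g j) *: b' j).
  by move=> i; apply: b'gen.
have /choice[M HM] : forall i, exists g : 'I_f -> k, Q (b' i - \sum_j iota (g j) *: b j).
  by move=> i; apply: bgen.
pose A := \matrix_(i, j) N i j; pose B := \matrix_(i, j) M i j.
apply: (@mulmx1_min k f f' A B); apply/matrixP => i l.
apply/eqP; rewrite -subr_eq0; apply/eqP.
apply: (bfree (fun l => (A *m B) i l - 1%:M i l)).
have -> : \sum_j iota ((A *m B) i j - 1%:M i j) *: b j =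
    - ((b i - \sum_j iota (N i j) *: b' j) +
      \sum_j iota (N i j) *: (b' j - \sum_m iota (M j m) *: b m)).
  have -> : \sum_j iota ((A *m B) i j - 1%:M i j) *: b j =
      \sum_j iota ((A *m B) i j) *: b j - b i.
    rewrite (eq_bigr _ (fun j _ => congr2 _ (rmorphB _ _ _) (erefl (b j)))).
    under eq_bigr do rewrite scalerBl.
    rewrite sumrB; congr (_ - _); rewrite (bigD1 i) //= !mxE eqxx rmorph1 scale1r.
    rewrite big1 ?addr0 // => j ji; rewrite mxE eq_sym (negPf ji) rmorph0 scale0r //.
  under [X in _ - _ + X]eq_bigr do rewrite scalerBr.
  rewrite sumrB addrA subrK opprB; congr (_ - _).
  under eq_bigr do rewrite mxE rmorph_sum scaler_suml.
  rewrite exchange_big /=; apply: eq_bigr => j _; rewrite scaler_sumr.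
  by apply: eq_bigr => m _; rewrite !mxE rmorphM scalerA.
apply: (max_idealN HQ); apply: (max_idealD HQ) => //.
apply: (max_ideal_sum HQ) => j _; rewrite in_algZ.
apply: (max_idealMl HQ) => //; exact: (valuation_ring_const HQ (N i j)).
Qed.

Lemma relative_degreeE f (b : 'I_f -> L) : residue_basis P Q b ->
  relative_degree P Q = f.
Proof.
move=> Hb; rewrite /relative_degree; case: xgetP => [f' _ /= [b' Hb']|/(_ f)].
  by apply/eqP; rewrite eqn_leq (residue_basis_leq Hb' Hb) (residue_basis_leq Hb Hb').
by case; exists b.
Qed.

End RelativeDegree.

Section Ramification.
Variables (k : Type) (K : fieldType) (iota : k -> K) (L : fieldExtType K).
Variables (OP : set K) (OQ : set L) (p : K) (t : L).
Hypothesis HP : dvr iota OP p.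
Hypothesis HQ : dvr (fun c => (iota c)%:A : L) OQ t.
Hypothesis OPQ : forall z, OP z -> OQ z%:A.

(** Evaluating the defining identity at the uniformizer p pins down the index. *)
Lemma ramification_indexE e (u : L) : (0 < e)%N -> units_of OQ u -> p%:A = t ^+ e * u ->
  ramification_index (max_ideal OP) (max_ideal OQ) = e.
Proof.
move=> e0 Uu pE.
have pe : place_val (max_ideal OQ) p%:A = e by rewrite pE (place_valE HQ e Uu).
have p1 : place_val (max_ideal OP) p = 1.
  by rewrite -[p]mulr1 (place_valE HP 1 (units_of1 HP)).
have val z : z != 0 -> place_val (max_ideal OQ) z%:A = e%:Z * place_val (max_ideal OP) z.
  move=> /(dvr_fact HP)[n [v [[v0 Ov Iv] ->]]].
  rewrite (place_valE HP) //.
  have -> : (p ^ n * v)%:A = t ^ (e%:Z * n) * (u ^ n * v%:A) :> L.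
    rewrite -[LHS]/(in_alg L _) rmorphM rmorphXz /= ?unitfE ?(dvr_neq0 HP) //.
    by rewrite pE expfzMl exprnP -exprz_exp mulrA.
  apply: (place_valE HQ); apply: (units_ofM HQ); first exact: (units_ofXz HQ).
  split; [|exact: OPQ|].
    by rewrite -[_%:A]/(in_alg L _) fmorph_eq0.
  by rewrite -[_%:A]/(in_alg L _) -fmorphV; apply: OPQ.
rewrite /ramification_index; case: xgetP => [e' _ /= [_ /(_ p (dvr_neq0 HP))]|/(_ e)].
  by rewrite pe p1 mulr1 => -[].
by case; split.
Qed.

End Ramification.

(** * The place at infinity of a rational function field *)

(** The results below use the rational functions only through this property and the
    injectivity of the embedding of polynomials. *)
Lemma tofrac_div (R : idomainType) (z : {fraction R}) :
  exists n d : R, d != 0 /\ z = tofrac n / tofrac d.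
Proof.
elim/quotW: z => x; exists (\n_x), (\d_x); split; first exact: denom_ratioP.
have d0 : (tofrac (\d_x) : {fraction R}) != 0 by rewrite tofrac_eq0 denom_ratioP.
apply: (mulIf d0); rewrite divfK //; unlock FracField.tofrac.
rewrite -[LHS]FracField.pi_mul; apply/eqmodP => /=.
rewrite FracField.equivfE /FracField.mulf !numden_Ratio ?mulf_neq0 ?oner_eq0 ?denom_ratioP //.
by rewrite !mulr1 mulrC.
Qed.

Lemma divf_divr (F : fieldType) (a b c : F) : c != 0 -> (a / c) / (b / c) = a / b.
Proof. by move=> c0; rewrite invfM invrK mulrACA mulVf // mulr1. Qed.

Lemma divf_neq0 (F : fieldType) (a b : F) : a != 0 -> b != 0 -> a / b != 0.
Proof. by move=> a0 b0; rewrite mulf_neq0 ?invr_eq0. Qed.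

Section Infinity.
Variables (k K : fieldType) (tf : {rmorphism {poly k} -> K}).
Hypothesis tf_inj : injective tf.
Hypothesis tf_div : forall z, exists n d : {poly k}, d != 0 /\ z = tf n / tf d.
Local Notation x := (tf 'X).
Implicit Types (p : {poly k}) (N : nat) (z : K).

Definition cstK : {rmorphism k -> K} := tf \o @polyC k.

Lemma cstK_comm : commr_rmorph cstK x^-1.
Proof. by move=> c; apply: mulrC. Qed.

(** The embedding of k[pi] into k(x) that sends pi to 1/x. *)
Definition at_inv : {rmorphism {poly k} -> K} := horner_morph cstK_comm.

Lemma tf_eq0 p : (tf p == 0) = (p == 0).
Proof. by rewrite -(inj_eq tf_inj) rmorph0. Qed.

Lemma tfX_neq0 : x != 0. Proof. by rewrite tf_eq0 polyX_eq0. Qed.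

Lemma at_invC c : at_inv c%:P = cstK c.
Proof. exact: horner_morphC. Qed.

Lemma at_invX : at_inv 'X = x^-1.
Proof. exact: horner_morphX. Qed.

(** The reciprocal x^N p(1/x) of a polynomial p of degree at most N. *)
Definition rev_poly N (p : {poly k}) := \poly_(i < N.+1) p`_(N - i).

Lemma size_rev_poly N p : (size (rev_poly N p) <= N.+1)%N.
Proof. exact: size_poly. Qed.

Lemma rev_polyK N p : (size p <= N.+1)%N -> rev_poly N (rev_poly N p) = p.
Proof.
move=> sp; apply/polyP => i; rewrite !coef_poly.
case: ltnP => [iN|Ni]; last by rewrite nth_default // (leq_trans sp).
by rewrite ltnS leq_subr subKn.
Qed.

Lemma at_inv_rev N p : (size p <= N.+1)%N ->
  at_inv p * x ^+ N = tf (rev_poly N p).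
Proof.
move=> sp; rewrite /at_inv /= /horner_morph (horner_coef_wide _ (n := N.+1)); last first.
  exact: leq_trans (size_poly _ _) sp.
rewrite /rev_poly poly_def rmorph_sum mulr_suml (reindex_inj rev_ord_inj) /=.
apply: eq_bigr => i _; rewrite coef_map /= subSS -mul_polyC rmorphM -mulrA /=; congr (_ * _).
have li : (i <= N)%N by rewrite -ltnS.
have -> : x ^+ N = x ^+ (N - i) * x ^+ i by rewrite -exprD subnK.
rewrite [RHS]rmorphXn exprVn mulrA mulVf ?mul1r //.
by rewrite expf_neq0 // tfX_neq0.
Qed.

Lemma at_inv_revE N p : (size p <= N.+1)%N ->
  at_inv (rev_poly N p) = tf p / x ^+ N.
Proof.
move=> sp; rewrite -{2}(rev_polyK sp) -at_inv_rev ?size_rev_poly //.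
by rewrite mulfK // expf_neq0 // tfX_neq0.
Qed.

Lemma at_inv_eq0 p : (at_inv p == 0) = (p == 0).
Proof.
apply/eqP/eqP => [p0|->]; last exact: rmorph0.
have sp : (size p <= (size p).+1)%N by [].
have := at_inv_rev sp; rewrite p0 mul0r => /eqP; rewrite eq_sym tf_eq0 => /eqP r0.
by rewrite -(rev_polyK sp) r0; apply/polyP => i; rewrite !coef_poly !coef0 if_same.
Qed.

Lemma at_inv_frac z : exists p d, at_inv d != 0 /\ z = at_inv p / at_inv d.
Proof.
have [n [d [d0 ->]]] := tf_div z; pose N := maxn (size n) (size d).
have sn : (size n <= N.+1)%N by rewrite leqW // leq_maxl.
have sd : (size d <= N.+1)%N by rewrite leqW // leq_maxr.
exists (rev_poly N n), (rev_poly N d).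
have xN : x ^+ N != 0 by rewrite expf_neq0 // tfX_neq0.
rewrite (at_inv_revE sn) (at_inv_revE sd) (divf_divr _ _ xN); split=> //.
by apply: divf_neq0 xN; rewrite tf_eq0.
Qed.

(** The local ring at infinity, as the localization of k[1/x] at (1/x). *)
Definition O_inf : set K := localization at_inv (root^~ 0).

Lemma O_inf_dvr : dvr (cstK) O_inf x^-1.
Proof.
rewrite -at_invX; apply: localization_dvr.
- by move=> c; exists c%:P; rewrite at_invC.
- exact: at_inv_frac.
- by move=> p /eqP; rewrite at_inv_eq0 => /eqP ->; rewrite root0.
- by move=> p q /rootP Hp /rootP Hq; apply/rootP; rewrite hornerD hornerN Hp Hq subr0.
- by move=> p q; rewrite rootM.
- by rewrite root1.
- by rewrite rootX.
- by rewrite at_inv_eq0 polyX_eq0.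
- move=> p /factor_theorem[q ->]; exists 1, q; rewrite root1; split=> //.
  by rewrite mul1r subr0 mulrC.
- move=> p; rewrite at_inv_eq0 => p0.
  have [m [q Hq ->]] := multiplicity_XsubC p 0.
  exists m, 1, q; rewrite p0 /= in Hq; split=> //.
  by rewrite subr0 mulr1 mulrC.
Qed.

(** Multiplying numerator and denominator by a power of x exchanges fractions of
    polynomials in 1/x and fractions of polynomials in x; the constant coefficient
    of the denominator becomes its coefficient of top degree. *)
Lemma max_ideal_inf : max_ideal O_inf =
  [set z | exists g h : {poly k},
    [/\ h != 0, z = tf g / tf h & (deg g < deg h)%E]]%classic.
Proof.
have x0 n : x ^+ n != 0 by rewrite expf_neq0 // tfX_neq0.
apply/esym/seteqP; split=> z.
  case=> g [h [h0 -> gh]]; apply/(dvr_max_idealE O_inf_dvr).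
  pose N := (size h).-1; have sh : size h = N.+1 by rewrite prednK // lt0n size_poly_eq0.
  have sg : (size g <= N)%N.
    move: gh; rewrite /deg (negPf h0); have [->|g0] := eqVneq g 0; first by rewrite size_poly0.
    by rewrite lte_fin ltz_nat -/N -ltnS prednK // lt0n size_poly_eq0.
  have : root (rev_poly N g) 0.
    by apply/rootP; rewrite horner_coef0 coef_poly /= subn0 nth_default.
  case/factor_theorem => q; rewrite subr0 => qE.
  exists (at_inv q / at_inv (rev_poly N h)).
    exists q, (rev_poly N h); split=> //.
    by rewrite /root horner_coef0 coef_poly /= subn0 -lead_coefE lead_coef_eq0.
  have E : at_inv (rev_poly N g) = at_inv q * x^-1 by rewrite qE rmorphM at_invX.
  rewrite mulrA [x^-1 * _]mulrC -E.
  have sh' : (size h <= N.+1)%N by rewrite sh.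
  rewrite (at_inv_revE (leqW sg)) (at_inv_revE sh') divf_divr //.
case/(dvr_max_idealE O_inf_dvr) => _ [p [s [s0 ->]]] ->.
pose N := maxn (size p) (size s).
have sp : (size p <= N)%N by rewrite leq_maxl.
have ss : (size s <= N.+1)%N by rewrite leqW // leq_maxr.
have sX : (size (p * 'X)%R <= N.+1)%N.
  by apply: leq_trans (size_polyMleq _ _) _; rewrite size_polyX addn2.
have cN : (rev_poly N s)`_N = s.[0] by rewrite coef_poly leqnn subnn horner_coef0.
exists (rev_poly N (p * 'X)), (rev_poly N s).
have r0 : rev_poly N s != 0.
  by apply: contraNneq s0 => r0; rewrite /root -cN r0 coef0.
split=> //.
  rewrite -!at_inv_rev // rmorphM at_invX invfM mulrACA mulfV // mulr1.
  by rewrite [_ * x^-1]mulrC mulrA.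
rewrite /deg (negPf r0); case: eqVneq => [_|g0]; first exact: ltNyr.
rewrite lte_fin ltz_nat.
have -> : size (rev_poly N s) = N.+1.
  apply/eqP; rewrite eqn_leq size_rev_poly /=; apply/negPn; rewrite -ltnNge ltnS.
  by apply/negP => /leq_sizeP/(_ N (leqnn _)); rewrite cN; apply/eqP.
rewrite prednK ?lt0n ?size_poly_eq0 //; apply/leq_sizeP => j Nj.
rewrite coef_poly; case: ltnP => // jN; rewrite coefMX.
by have -> : (N - j = 0)%N by apply/eqP; rewrite subn_eq0.
Qed.

Lemma at_inv_O p : O_inf (at_inv p).
Proof. by exists p, 1; rewrite root1 rmorph1 divr1. Qed.

Lemma O_inf_residue z : O_inf z -> exists c, max_ideal O_inf (z - cstK c).
Proof.
case=> p [s [s0 ->]]; exists (p.[0] / s.[0]); apply/(dvr_max_idealE O_inf_dvr).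
have s00 : s.[0] != 0 by [].
have : root (p - (p.[0] / s.[0])%:P * s) 0.
  by rewrite /root !hornerE divfK // subrr.
case/factor_theorem => q; rewrite subr0 => qE.
exists (at_inv q / at_inv s); first by exists q, s.
have is0 : at_inv s != 0.
  by rewrite at_inv_eq0; apply: contraNneq s0 => ->; rewrite root0.
rewrite mulrA -at_invX -rmorphM [_ * q]mulrC -qE rmorphB mulrBl.
by rewrite [at_inv (_ * s)]rmorphM at_invC mulfK.
Qed.

End Infinity.

(** * Irreducible polynomials *)

Section Irreducible.
Variable k : fieldType.
Implicit Types p q G : {poly k}.

Lemma irred_coprimep G p : irreducible_poly G -> coprimep G p = ~~ (G %| p).
Proof.
move=> irrG; apply/idP/idP => [cGp|].
  by apply/negP => /(coprimepP _ _ cGp _ (dvdpp G)); rewrite -size_poly_eq1; case: irrG => /gtn_eqF->.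
apply: contraNT => ncop.
have [//|] := irredp_XsubCP irrG (dvdp_gcdl G p).
  by rewrite -size_poly_eq1 => gcd1; rewrite /coprimep gcd1 in ncop.
by move=> /eqp_dvdl <-; apply: dvdp_gcdr.
Qed.

Lemma irred_dvdpM G p q : irreducible_poly G -> (G %| p * q) = (G %| p) || (G %| q).
Proof.
move=> irrG; apply/idP/orP => [Gpq|[Gp|Gq]]; last 2 first.
- exact: dvdp_mulr.
- exact: dvdp_mull.
have [|NGp] := boolP (G %| p); [by left|right].
by rewrite -(Gauss_dvdpr _ (_ : coprimep G p)) // irred_coprimep.
Qed.

Lemma irred_ndvd1 G : irreducible_poly G -> ~~ (G %| 1).
Proof. by case=> sG _; rewrite dvdp1; apply/eqP => E; rewrite E in sG. Qed.

Lemma irred_ndvdX G p n : irreducible_poly G -> ~~ (G %| p) -> ~~ (G %| p ^+ n).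
Proof.
move=> irrG Gp; elim: n => [|n IH]; first by rewrite expr0 irred_ndvd1.
by rewrite exprS irred_dvdpM // negb_or Gp.
Qed.

Lemma irred_ndvdC G (c : k) : irreducible_poly G -> c != 0 -> ~~ (G %| c%:P).
Proof.
case=> sG _ c0; apply/negP => /dvdp_leq; rewrite polyC_eq0 size_polyC c0 => /(_ isT).
by rewrite leqNgt sG.
Qed.

Lemma irred_inv G p : irreducible_poly G -> ~~ (G %| p) -> exists u, G %| u * p - 1.
Proof.
move=> irrG; rewrite -irred_coprimep // => /Bezout_eq1_coprimepP[[u v] /= E].
by exists v; rewrite -E opprD addrCA subrr addr0 dvdpNr dvdp_mull.
Qed.

Lemma irred_monic_coprime G1 G2 : irreducible_poly G1 -> irreducible_poly G2 ->
  G1 \is monic -> G2 \is monic -> G1 != G2 -> coprimep G1 G2.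
Proof.
move=> irr1 irr2 m1 m2; apply: contraNT; rewrite irred_coprimep // negbK => G12.
rewrite -eqp_monic //; apply: irr2 => //.
by case: irr1 => /gtn_eqF->.
Qed.

End Irreducible.

(** * The theorem of Dedekind and Kummer at infinity *)

Section Kummer.
Variables (k K : fieldType) (tf : {rmorphism {poly k} -> K}).
Hypothesis tf_inj : injective tf.
Hypothesis tf_div : forall z, exists n d : {poly k}, d != 0 /\ z = tf n / tf d.
Variables (F : fieldExtType K) (theta : F).
Implicit Types (p q : {poly {poly k}}) (g G : {poly k}).

Definition inF : {rmorphism {poly k} -> F} := in_alg F \o at_inv tf.

Lemma inF_comm : commr_rmorph inF theta.
Proof. by move=> c; apply: mulrC. Qed.

(** An element of k[pi][T] is evaluated at pi = 1/x and T = theta; its image is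
    the ring k[pi][theta]. *)
Definition eval_at : {rmorphism {poly {poly k}} -> F} := horner_morph inF_comm.
Local Notation ev := eval_at.

(** Reduction modulo pi. *)
Definition red : {rmorphism {poly {poly k}} -> {poly k}} := map_poly (horner_eval 0).
Definition lift_poly : {rmorphism {poly k} -> {poly {poly k}}} := map_poly polyC.

Lemma red_lift_poly g : red (lift_poly g) = g.
Proof.
by apply/polyP => i; rewrite /= coef_map coef_map /= /horner_eval hornerC.
Qed.

Lemma redC g : red g%:P = (g.[0])%:P.
Proof. by rewrite /= map_polyC. Qed.

Lemma redX : red 'X = 'X.
Proof. by rewrite /= map_polyX. Qed.

Lemma red_ker p : red p = 0 -> exists q, p = 'X%:P * q.
Proof.
move=> rp; exists (map_poly (fun c : {poly k} => c %/ 'X) p); apply/polyP => i.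
rewrite coefCM coef_map_id0 ?div0p // mulrC divpK //.
have /eqP : (red p)`_i = 0 by rewrite rp coef0.
by rewrite coef_map /= -[_ == 0]/(root p`_i 0) -dvdp_XsubCl subr0.
Qed.

Lemma red_eq p q : red p = red q -> exists r, p = q + 'X%:P * r.
Proof.
move=> rpq; have [|r E] := @red_ker (p - q); first by rewrite rmorphB rpq subrr.
by exists r; rewrite -E addrC subrK.
Qed.

Lemma evC g : ev g%:P = (at_inv tf g)%:A.
Proof. exact: horner_morphC. Qed.

Lemma evX : ev 'X = theta.
Proof. exact: horner_morphX. Qed.

Lemma inF_eq0 g : (inF g == 0) = (g == 0).
Proof. by rewrite fmorph_eq0 at_inv_eq0. Qed.

Lemma evC_eq0 g : (ev g%:P == 0) = (g == 0).
Proof. by rewrite evC -(inF_eq0 g). Qed.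

Lemma evE p : ev p = (map_poly (in_alg F) (map_poly (at_inv tf) p)).[theta].
Proof. by rewrite -map_poly_comp. Qed.

Variable Phi : {poly {poly k}}.
Hypothesis Phi_monic : Phi \is monic.
Hypothesis Phi_root : ev Phi = 0.
Hypothesis theta_gen : <<1%VS; theta>>%VS = fullv.
Hypothesis Phi_size : size Phi = (\dim {: F}).+1.

(** By its degree, Phi is the minimal polynomial of theta. Division with remainder
    by the monic Phi stays within k[pi][T]. *)
Lemma ev_ker p : ev p = 0 -> exists q, p = q * Phi.
Proof.
move=> p0; exists (rdivp p Phi).
rewrite {1}(rdivp_eq Phi_monic p).
suff -> : rmodp p Phi = 0 by rewrite addr0.
set r := rmodp p Phi.
have r0 : ev r = 0.
  apply/eqP; move: p0; rewrite (rdivp_eq Phi_monic p) rmorphD rmorphM.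
  by rewrite Phi_root mulr0 add0r => ->.
have sr : (size r < size Phi)%N by rewrite ltn_rmodp monic_neq0.
have rK0 : map_poly (in_alg F) (map_poly (at_inv tf) r) = 0.
  have minr : minPoly 1 theta %| map_poly (in_alg F) (map_poly (at_inv tf) r).
    apply: minPoly_dvdp; first by apply/polyOver1P; exists (map_poly (at_inv tf) r).
    by apply/rootP; rewrite -evE.
  apply/eqP; apply: contraTT sr => rn0; rewrite -leqNgt Phi_size.
  have := dvdp_leq rn0 minr; rewrite size_minPoly.
  have := dim_Fadjoin 1 theta; rewrite theta_gen dimv1 muln1 => <- H.
  apply: leq_trans H _; rewrite size_map_poly; exact: size_poly.
apply/polyP => i; apply/eqP; rewrite coef0 -inF_eq0.
have /eqP := congr1 (fun q : {poly F} => q`_i) rK0.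
by rewrite coef0 !coef_map.
Qed.

Lemma ev_frac_poly (q : {poly K}) : exists p (d : {poly k}),
  d != 0 /\ (map_poly (in_alg F) q).[theta] = ev p / ev d%:P.
Proof.
elim/poly_ind: q => [|q c [p [d [d0 E]]]].
  by exists 0, 1; rewrite oner_neq0 rmorph0 horner0 rmorph0 mul0r.
have [a [b [b0 cE]]] := at_inv_frac tf_inj tf_div c.
rewrite at_inv_eq0 // in b0.
exists (p * 'X * b%:P + a%:P * d%:P), (d * b); split; first by rewrite mulf_neq0.
have [d00 b00] : ev d%:P != 0 /\ ev b%:P != 0 by rewrite !evC_eq0.
rewrite rmorphD rmorphM /= map_polyX map_polyC /= hornerMXaddC E cE polyCM.
rewrite [ev (_ + _)]rmorphD ![ev (_ * _)]rmorphM evX.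
have -> : (at_inv tf a / at_inv tf b)%:A = ev a%:P / ev b%:P.
  by rewrite !evC -[LHS]/(in_alg F _) fmorph_div.
rewrite [_ / _ * theta]mulrAC.
rewrite (addf_div _ _ d00 b00).
reflexivity.
Qed.

Lemma ev_frac z : exists p (d : {poly k}), d != 0 /\ z = ev p / ev d%:P.
Proof.
have : z \in <<1%VS; theta>>%VS by rewrite theta_gen memvf.
by case/Fadjoin1_polyP => q ->; apply: ev_frac_poly.
Qed.

(** Clear the denominators of the inverse of ev p. *)
Lemma ev_dvdC p : ev p != 0 -> exists q (d : {poly k}), d != 0 /\ ev (p * q) = ev d%:P.
Proof.
move=> p0; have [q [d [d0 E]]] := ev_frac (ev p)^-1.
exists q, d; split=> //; rewrite rmorphM; apply/eqP.
have dn : ev d%:P != 0 by rewrite evC_eq0.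
by rewrite -(inj_eq (mulIf (_ : (ev d%:P)^-1 != 0))) ?invr_eq0 // -mulrA -E !mulfV.
Qed.

(** Dedekind's criterion: if e > 1, Phi must not vanish to order 2 at the point
    G = pi = 0, which is to say that S is prime to G modulo pi. *)
Definition regular_factor (G : {poly k}) (e : nat) :=
  exists Gt H S, [/\ Phi = Gt ^+ e * H + 'X%:P * S, red Gt = G, ~~ (G %| red H)
    & e = 1%N \/ ~~ (G %| red S)].

Local Notation iotaF := (fun c => (cstK tf c)%:A : F).
Local Notation OK := (O_inf tf).

Section AtFactor.
Variables (G : {poly k}) (e : nat).
Hypothesis irrG : irreducible_poly G.
Hypothesis e_gt0 : (0 < e)%N.
Hypothesis regG : regular_factor G e.

(** The prime (pi, G(theta)) of k[pi][theta], pulled back to k[pi][T]. *)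
Definition prime_above p := G %| red p.

Lemma redPhi_dvd : G %| red Phi.
Proof.
case: regG => Gt [H [S [-> rG _ _]]].
rewrite rmorphD !rmorphM rmorphXn rG redC hornerX polyC0 mul0r addr0.
by apply/dvdp_mulr/dvdp_exp.
Qed.

Lemma prime_above_ker p : ev p = 0 -> prime_above p.
Proof.
by case/ev_ker => q ->; rewrite /prime_above rmorphM; apply/dvdp_mull/redPhi_dvd.
Qed.

Lemma prime_above_neq0 p : ~~ prime_above p -> ev p != 0.
Proof. by apply: contraNneq => /prime_above_ker. Qed.

Lemma prime_above_sub p q : prime_above p -> prime_above q -> prime_above (p - q).
Proof. by rewrite /prime_above rmorphB => Gp Gq; apply: dvdp_sub. Qed.

Lemma prime_above_mul p q : prime_above (p * q) = prime_above p || prime_above q.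
Proof. by rewrite /prime_above rmorphM; apply: irred_dvdpM. Qed.

Lemma prime_above1 : ~~ prime_above 1.
Proof. by rewrite /prime_above rmorph1 irred_ndvd1. Qed.

Lemma prime_above_expn p n : ~~ prime_above p -> ~~ prime_above (p ^+ n).
Proof. by rewrite /prime_above rmorphXn; apply: irred_ndvdX. Qed.

Lemma prime_above_const g : g.[0] != 0 -> ~~ prime_above g%:P.
Proof. by rewrite /prime_above redC; apply: irred_ndvdC. Qed.

(** If e = 1, multiplying an element of the prime by a lift of the cofactor of G
    makes its reduction divisible by that of Phi, hence turns it into a multiple of
    pi. If S is prime to G, the relation S pi = - G^e H turns pi, and with it the
    whole prime, into multiples of G(theta). *)
Lemma local_uniformizer : exists t, [/\ prime_above t, ev t != 0,
  forall p, prime_above p -> exists s q, ~~ prime_above s /\ ev (s * p) = ev (t * q)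
  & exists s1 s2, [/\ ~~ prime_above s1, ~~ prime_above s2 & ev (s1 * 'X%:P) = ev (t ^+ e * s2)]].
Proof.
have [Gt [H [S [PhiE rG HG HS]]]] := regG.
have rPhi : red Phi = G ^+ e * red H.
  by rewrite PhiE rmorphD !rmorphM rmorphXn rG redC hornerX polyC0 mul0r addr0.
case: HS => [e1|SG].
  exists 'X%:P; split.
  - by rewrite /prime_above redC hornerX dvdp0.
  - by rewrite evC_eq0 polyX_eq0.
  - move=> p /dvdpP[c pE]; exists H.
    have [|r E] := @red_eq (H * p) (Phi * lift_poly c).
      by rewrite !rmorphM red_lift_poly rPhi pE e1 expr1 [LHS]mulrC [c * G]mulrC mulrAC.
    by exists r; rewrite E rmorphD [ev (Phi * _)]rmorphM Phi_root mul0r add0r.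
  by exists 1, 1; rewrite prime_above1 e1 expr1 mul1r mulr1.
have XS : ev ('X%:P * S) = - ev (Gt ^+ e * H).
  by apply/eqP; rewrite -addr_eq0 -rmorphD addrC -PhiE Phi_root.
have t0 : ev Gt != 0.
  apply: contraNneq SG => t0; apply: prime_above_ker.
  move/eqP: XS; rewrite !rmorphM rmorphXn t0 expr0n gtn_eqF // mul0r oppr0 mulf_eq0.
  by rewrite evC_eq0 polyX_eq0 => /eqP.
exists Gt; split=> //; first by rewrite /prime_above rG.
  move=> p /dvdpP[c pE]; exists S.
  have [|r E] := @red_eq p (Gt * lift_poly c).
    by rewrite rmorphM red_lift_poly rG mulrC.
  exists (S * lift_poly c - Gt ^+ e.-1 * H * r); split=> //.
  rewrite E mulrDr !mulrBr !rmorphD; congr (_ + _); first by rewrite mulrCA.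
  rewrite mulrA [S * _]mulrC [LHS]rmorphM XS mulNr -rmorphM -rmorphN; congr (ev (- _)).
  by rewrite !mulrA -exprS prednK.
exists S, (- H); split=> //; first by rewrite /prime_above rmorphN dvdpNr.
by rewrite mulrC XS mulrN rmorphN.
Qed.

Definition local_ring : set F := localization ev prime_above.

Lemma local_ring_spec : exists t u, [/\ dvr iotaF local_ring t, units_of local_ring u,
    ((tf 'X)^-1)%:A = t ^+ e * u,
    forall p, max_ideal local_ring (ev p) <-> prime_above p
  & forall V, valuation_ring iotaF V -> (forall p, V (ev p)) ->
      (forall p, max_ideal V (ev p) <-> prime_above p) -> V = local_ring].
Proof.
have [t [Mt t0 tgen [s1 [s2 [Ms1 Ms2 E]]]]] := local_uniformizer.
have constF c : exists p, iotaF c = ev p by exists c%:P%:P; rewrite evC at_invC.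
have fracF z : exists p d, ev d != 0 /\ z = ev p / ev d.
  by have [p [d [d0 ->]]] := ev_frac z; exists p, d%:P; rewrite evC_eq0.
have dvdF p : ev p != 0 -> exists n q s, ~~ prime_above s /\ ev (p * q) = ev (t ^+ n * s).
  case/ev_dvdC => q [d [d0 Epq]].
  have [m [d' Hd' dE]] := multiplicity_XsubC d 0; rewrite d0 /= in Hd'.
  exists (e * m)%N, (q * s1 ^+ m), (s2 ^+ m * d'%:P); split.
    by rewrite prime_above_mul negb_or prime_above_expn // prime_above_const.
  rewrite mulrA [LHS]rmorphM Epq dE subr0 polyCM polyC_exp -rmorphM.
  rewrite -mulrA -exprMn mulrC ['X%:P * s1]mulrC [LHS]rmorphM rmorphXn E.
  by rewrite -rmorphXn -rmorphM exprMn exprM mulrA.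
have Odvr : dvr iotaF local_ring (ev t).
  exact: (localization_dvr constF fracF prime_above_ker prime_above_sub prime_above_mul prime_above1 Mt t0 tgen dvdF).
exists (ev t), (ev s2 / ev s1); split=> //.
- exact: (localization_units prime_above_ker Ms2 Ms1).
- have s10 : ev s1 != 0 by apply: prime_above_neq0.
  rewrite -at_invX -evC; apply: (mulfI s10).
  rewrite [RHS]mulrCA [X in _ = _ * X]mulrC divfK // -rmorphXn.
  by rewrite -!rmorphM.
- exact: (localization_max_ideal constF fracF prime_above_ker prime_above_sub prime_above_mul prime_above1 Mt t0 tgen dvdF).
- exact: (localization_unique constF fracF prime_above_ker prime_above_sub prime_above_mul prime_above1 Mt t0 tgen dvdF).
Qed.

Lemma O_inf_local_ring z : OK z -> local_ring z%:A.
Proof.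
case=> p [s [s0 ->]]; exists p%:P, s%:P; split; first exact: prime_above_const.
by rewrite !evC -[LHS]/(in_alg F _) fmorph_div.
Qed.

Lemma max_ideal_inf_local_ring z : max_ideal OK z -> max_ideal local_ring z%:A.
Proof.
have [t [u [Odvr Uu pE Mev _]]] := local_ring_spec.
case/(dvr_max_idealE (O_inf_dvr tf_inj tf_div)) => v Ov ->.
rewrite -[_%:A]/(in_alg F _) rmorphM.
apply: (max_idealMr (dvr_valuation_ring Odvr)) (O_inf_local_ring Ov) _.
rewrite [X in max_ideal _ X](_ : _ = ev 'X%:P); last by rewrite evC at_invX.
by apply/Mev; rewrite /prime_above redC hornerX dvdp0.
Qed.

(** The residue field is k[T]/(G), with basis the powers of T below deg G. *)
Lemma residue_basis_at : residue_basis (max_ideal OK) (max_ideal local_ring)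
  (fun i : 'I_(size G).-1 => theta ^+ i).
Proof.
have [t [u [Odvr Uu pE Mev _]]] := local_ring_spec.
have HO := dvr_valuation_ring Odvr.
have HK := dvr_valuation_ring (O_inf_dvr tf_inj tf_div).
have evlift (g : 'I_(size G).-1 -> k) :
    \sum_i cstK tf (g i) *: theta ^+ i = ev (lift_poly (\sum_i g i *: 'X^i)).
  rewrite !rmorph_sum /=; apply: eq_bigr => i _.
  rewrite -mul_polyC rmorphM /= map_polyC map_polyXn [RHS]rmorphM rmorphXn evX evC at_invC.
  by rewrite mulr_algl.
have Oth : local_ring theta by rewrite -evX; apply: localization_ev; exact: prime_above1.
have sG : (size G).-1.+1 = size G by rewrite prednK //; case: irrG => /ltnW.
split.
- by move=> i; rewrite (place_ringE HO); apply: (vringX HO).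
- rewrite (place_ringE HK) => c Oc Mc.
  have /choice[g Hg] : forall i, exists a : k, max_ideal OK (c i - cstK tf a).
    by move=> i; apply: O_inf_residue.
  suff g0 i : g i = 0 by move=> i; have := Hg i; rewrite g0 rmorph0 subr0.
  have : max_ideal local_ring (\sum_i cstK tf (g i) *: theta ^+ i).
    have -> : \sum_i cstK tf (g i) *: theta ^+ i =
       \sum_i c i *: theta ^+ i - \sum_i (c i - cstK tf (g i)) *: theta ^+ i.
      by rewrite -sumrB; apply: eq_bigr => j _; rewrite -scalerBl opprB addrCA subrr addr0.
    apply: (max_idealB HO) => //; apply: (max_ideal_sum HO) => j _.
    rewrite -mulr_algl; apply: (max_idealMr HO); first exact: (vringX HO).
    exact: max_ideal_inf_local_ring.
  rewrite evlift => /Mev; rewrite /prime_above red_lift_poly => Gg.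
  have g0 : \sum_i g i *: 'X^i = 0.
    apply/eqP; apply: contraTT Gg => /dvdp_leq H; apply/negP => /H; apply/negP.
    rewrite -ltnNge -[X in (_ < X)%N]sG ltnS.
    apply: leq_trans (size_sum _ _ _) _; apply/bigmax_leqP => j _.
    by apply: leq_trans (size_scale_leq _ _) _; rewrite size_polyXn.
  have := congr1 (fun p : {poly k} => p`_i) g0; rewrite coef0 coef_sum (bigD1 i) //=.
  rewrite coefZ coefXn eqxx mulr1 big1 ?addr0 // => j ji.
  by rewrite coefZ coefXn -(inj_eq val_inj) eq_sym in ji *; rewrite (negPf ji) mulr0.
- rewrite (place_ringE HO) (place_ringE HK) => _ [p [s [Ms ->]]].
  have [w Hw] := irred_inv irrG Ms.
  pose g := (red p * w) %% G.
  have sg : (size g <= (size G).-1)%N by rewrite -ltnS sG ltn_modp irredp_neq0.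
  exists (fun i => cstK tf g`_i); first by move=> i; apply: (valuation_ring_const HK).
  rewrite (evlift (fun i => g`_i)).
  have -> : \sum_(i < (size G).-1) g`_i *: 'X^i = g.
    rewrite -poly_def; apply/polyP => j; rewrite coef_poly; case: ltnP => // gj.
    by rewrite nth_default // (leq_trans sg).
  have s0 : ev s != 0 by apply: prime_above_neq0.
  have -> : ev p / ev s - ev (lift_poly g) = ev (p - lift_poly g * s) / ev s.
    by rewrite rmorphB mulrBl rmorphM mulfK.
  apply: (max_idealMr HO); first by exists 1, s; rewrite rmorph1 mul1r.
  apply/Mev; rewrite /prime_above rmorphB rmorphM red_lift_poly.
  have -> : red p - g * red s =
      (red p * w) %/ G * red s * G - red p * (w * red s - 1).
    have gE : g = red p * w - (red p * w) %/ G * G.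
      by rewrite [X in X - _](divp_eq _ G) addrC addKr.
    by rewrite gE; ring.
  by apply: dvdp_sub; [apply: dvdp_mull|apply: dvdp_mull].
Qed.

End AtFactor.

(** Any lifts of G and h will do: their product differs from Phi by a multiple of
    pi. *)
Lemma regular_simple G h : red Phi = G * h -> ~~ (G %| h) -> regular_factor G 1.
Proof.
move=> E Gh; have [|S PhiE] := @red_eq Phi (lift_poly G * lift_poly h).
  by rewrite rmorphM !red_lift_poly.
by exists (lift_poly G), (lift_poly h), S; rewrite expr1 !red_lift_poly; split=> //; left.
Qed.

Section Completeness.
Variable V : set F.
Hypothesis HV : valuation_ring iotaF V.
Hypothesis V_inf : forall z, max_ideal OK z -> max_ideal V z%:A.

Lemma above_inf_ring z : OK z -> V z%:A.
Proof.
have HK := dvr_valuation_ring (O_inf_dvr tf_inj tf_div).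
by apply: (above_ring HV _ V_inf) => ?; apply: O_inf_residue.
Qed.

(** Valuation rings are integrally closed. *)
Lemma above_inf_theta : V theta.
Proof.
apply: (vring_integral HV (p := map_poly inF Phi)); first exact: monic_map.
  by move=> i; rewrite coef_map /=; apply/above_inf_ring/at_inv_O.
by apply/rootP; rewrite -Phi_root.
Qed.

Lemma above_inf_ev p : V (ev p).
Proof.
rewrite -[ev p]/((map_poly inF p).[theta]) horner_coef; apply: (vring_sum HV) => i _.
apply: (valuation_ring_mul HV); last exact/(vringX HV)/above_inf_theta.
by rewrite coef_map /=; apply/above_inf_ring/at_inv_O.
Qed.

Lemma above_inf_red p q : red p = red q ->
  max_ideal V (ev q) -> max_ideal V (ev p).
Proof.
case/red_eq => r -> Mq; rewrite rmorphD; apply: (max_idealD HV) => //.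
rewrite rmorphM; apply: (max_idealMr HV); first exact: above_inf_ev.
rewrite evC at_invX; apply: V_inf.
exact: (dvr_max_ideal (O_inf_dvr tf_inj tf_div)).
Qed.

(** (pi, G(theta)) is a maximal ideal, because G is irreducible. *)
Lemma above_inf_factor G : irreducible_poly G -> max_ideal V (ev (lift_poly G)) ->
  forall p, max_ideal V (ev p) <-> prime_above G p.
Proof.
move=> irrG MG.
have sub p : prime_above G p -> max_ideal V (ev p).
  case/dvdpP => c pE; apply: (@above_inf_red _ (lift_poly c * lift_poly G)).
    by rewrite rmorphM !red_lift_poly.
  by rewrite rmorphM; apply: (max_idealMl HV) => //; apply: above_inf_ev.
move=> p; split=> [Mp|]; last exact: sub.
apply/negPn/negP => /(irred_inv irrG)[u].
have -> : u * red p - 1 = red (lift_poly u * p - 1) by rewrite rmorphB rmorphM red_lift_poly rmorph1.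
move/sub => M1; apply: (max_ideal1 HV).
have -> : 1 = ev (lift_poly u) * ev p - ev (lift_poly u * p - 1).
  by rewrite rmorphB rmorphM rmorph1 opprB addrCA subrr addr0.
by apply: (max_idealB HV) => //; apply: (max_idealMl HV) => //; apply: above_inf_ev.
Qed.

(** The product of the lifted factors is a multiple of Phi modulo pi, so it takes a
    value in the maximal ideal, which is prime. *)
Lemma above_inf_exists (s : seq ({poly k} * nat)) :
  red Phi %| \prod_(i <- s) i.1 ^+ i.2 ->
  exists2 i, i \in s & max_ideal V (ev (lift_poly i.1)).
Proof.
case/dvdpP => c E.
have : max_ideal V (\prod_(i <- s) ev (lift_poly i.1) ^+ i.2).
  have -> : \prod_(i <- s) ev (lift_poly i.1) ^+ i.2 = ev (\prod_(i <- s) lift_poly i.1 ^+ i.2).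
    by rewrite rmorph_prod; apply: eq_bigr => i _; rewrite rmorphXn.
  apply: (@above_inf_red _ (lift_poly c * Phi)).
    rewrite rmorphM red_lift_poly -E rmorph_prod; apply: eq_bigr => i _.
    by rewrite rmorphXn red_lift_poly.
  by rewrite rmorphM Phi_root mulr0; apply: (max_ideal0 HV).
case/(max_ideal_prime_prod HV) => [i|i si /(max_ideal_primeX HV) Mi].
  by apply/(vringX HV)/above_inf_ev.
by exists i => //; apply/Mi/above_inf_ev.
Qed.

End Completeness.

Section Signature.
Variable s : seq ({poly k} * nat).
Hypothesis s_irr : forall i, i \in s -> irreducible_poly i.1.
Hypothesis s_monic : forall i, i \in s -> i.1 \is monic.
Hypothesis s_pos : forall i, i \in s -> (0 < i.2)%N.
Hypothesis s_regular : forall i, i \in s -> regular_factor i.1 i.2.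
Hypothesis s_uniq : uniq [seq i.1 | i <- s].
Hypothesis s_prod : red Phi %| \prod_(i <- s) i.1 ^+ i.2.

Local Notation Pinf := (max_ideal OK).
Let place_at (i : {poly k} * nat) : set F := max_ideal (local_ring i.1).

Definition factor_ef (i : {poly k} * nat) : nat * nat := (i.2, (size i.1).-1).

Lemma place_at_above i : i \in s -> @places_above k K (cstK tf) F Pinf (place_at i).
Proof.
move=> si; split.
  have [t [u [Odvr _ _ _ _]]] := local_ring_spec (s_irr si) (s_pos si) (s_regular si).
  exact: (dvr_place Odvr).
exact: (max_ideal_inf_local_ring (s_irr si) (s_pos si) (s_regular si)).
Qed.

(** Distinct monic irreducible polynomials are coprime, so no proper ideal contains
    the values of both. *)
Lemma place_at_inj : {in s &, injective place_at}.
Proof.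
move=> i j si sj; rewrite /place_at => eij.
have [i1j1|ne] := eqVneq i.1 j.1.
  by apply/eqP; rewrite -(nth_index i si) -(nth_index i sj); apply/eqP; congr nth;
     apply/eqP; rewrite -(nth_uniq 0 _ _ s_uniq) ?size_map ?index_mem //
     !(nth_map i) ?index_mem // !nth_index // i1j1.
have [? [? [Odvr _ _ Mi _]]] := local_ring_spec (s_irr si) (s_pos si) (s_regular si).
have [? [? [_ _ _ Mj _]]] := local_ring_spec (s_irr sj) (s_pos sj) (s_regular sj).
exfalso; have : ~~ (i.1 %| j.1).
  rewrite -irred_coprimep; last exact: s_irr.
  by apply: irred_monic_coprime ne; rewrite ?s_monic //; apply: s_irr.
case/negP; rewrite -[j.1]red_lift_poly -/(prime_above i.1 _).
by apply/Mi; rewrite eij; apply/Mj; rewrite /prime_above red_lift_poly.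
Qed.

Lemma places_above_inf :
  @places_above k K (cstK tf) F Pinf = [set` [seq place_at i | i <- s]]%classic.
Proof.
apply/seteqP; split=> Q /=; last by case/mapP => i si ->; apply: place_at_above.
case=> /placeP[V HV ->] PV.
have [i si Mi] := above_inf_exists HV PV s_prod.
apply/mapP; exists i => //; rewrite /place_at; congr max_ideal.
have [? [? [_ _ _ _ uniqV]]] := local_ring_spec (s_irr si) (s_pos si) (s_regular si).
apply: uniqV => //; first exact: above_inf_ev.
exact: (above_inf_factor HV PV (s_irr si)).
Qed.

Lemma place_at_ef i : i \in s ->
  (ramification_index Pinf (place_at i), relative_degree Pinf (place_at i)) =
  factor_ef i.
Proof.
move=> si; have [irr pos reg] := And3 (s_irr si) (s_pos si) (s_regular si).
have [t [u [Odvr Uu pE _ _]]] := local_ring_spec irr pos reg.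
have HK := O_inf_dvr tf_inj tf_div; have HK' := dvr_valuation_ring HK.
congr (_, _).
  exact: (ramification_indexE HK Odvr (O_inf_local_ring irr) pos Uu pE).
apply: (relative_degreeE HK' (dvr_valuation_ring Odvr)).
- by move=> z; apply: O_inf_residue.
- exact: (max_ideal_inf_local_ring irr pos reg).
- exact: (residue_basis_at irr pos reg).
Qed.

(** Dedekind-Kummer. Sorting makes the order of the factors in s immaterial. *)
Theorem signature_inf : signature (cstK tf) F Pinf =
  flatten [seq [:: ef.1; ef.2] | ef <-
    sort (fun e f : nat *l nat => (e <= f)%O) [seq factor_ef i | i <- s]].
Proof.
rewrite /signature places_above_inf; congr (flatten (map _ _)).
have lexi_total : total (fun e f : nat *l nat => (e <= f)%O) by move=> e f; apply: le_total.
have lexi_trans : transitive (fun e f : nat *l nat => (e <= f)%O).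
  by move=> e f g; apply: le_trans.
have lexi_anti : antisymmetric (fun e f : nat *l nat => (e <= f)%O).
  by move=> e f; apply: le_anti.
apply/(perm_sortP lexi_total lexi_trans lexi_anti).
have -> : [seq factor_ef i | i <- s] =
    [seq (ramification_index Pinf Q, relative_degree Pinf Q)
    | Q <- [seq place_at i | i <- s]].
  by rewrite -map_comp; apply/eq_in_map => i si /=; rewrite place_at_ef.
apply/perm_map/uniq_perm.
- exact: fset_uniq.
- rewrite map_inj_in_uniq; first exact: map_uniq s_uniq.
  exact: place_at_inj.
move=> Q; rewrite in_fset_set; last exact: finite_seq.
by apply/idP/idP; rewrite inE.
Qed.

End Signature.

Corollary signature_inf_squarefree (Gs : seq {poly k}) :
  (forall G, G \in Gs -> irreducible_poly G) -> (forall G, G \in Gs -> G \is monic) ->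
  uniq Gs -> red Phi = \prod_(G <- Gs) G ->
  signature (cstK tf) F (max_ideal OK) =
  flatten [seq [:: ef.1; ef.2] | ef <-
    sort (fun e f : nat *l nat => (e <= f)%O) [seq (1%N, (size (G : {poly k})).-1) | G <- Gs]].
Proof.
move=> irr mon uGs E.
have GsP (i : {poly k} * nat) : i \in [seq (G, 1%N) | G <- Gs] -> i.1 \in Gs /\ i.2 = 1%N.
  by case/mapP => G GGs ->.
rewrite (@signature_inf [seq (G, 1%N) | G <- Gs]) -?map_comp //.
- by move=> i /GsP[/irr].
- by move=> i /GsP[/mon].
- by move=> i /GsP[_ ->].
- move=> i /GsP[Gi ->]; rewrite (big_rem _ Gi) in E; apply: (regular_simple E).
  rewrite big_seq; elim/big_rec: _ => [|G p]; first exact/irred_ndvd1/irr.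
  rewrite mem_rem_uniq // inE => /andP[Gne GGs] Gp.
  rewrite irred_dvdpM ?negb_or ?Gp ?andbT; last exact: irr.
  rewrite -irred_coprimep; last exact: irr.
  by apply: irred_monic_coprime (mon _ Gi) (mon _ GGs) _; [exact: irr|exact: irr|rewrite eq_sym].
- by rewrite map_id_in // => G _.
- rewrite big_map E.
  by rewrite (eq_bigr id) // => G _; rewrite expr1.
Qed.

End Kummer.

(** * Cubic equations with coefficients polynomial in 1/x *)

(** The substitution w = c + L / z in P w^3 - a w + b = 0. The constant coefficient
    in w - c is L, which becomes the leading coefficient for 1 / (w - c); the factor L
    in z makes the equation monic. *)
Lemma moebius_cubic (F : fieldType) (w P a b c : F) (L := P * c ^+ 3 - a * c + b)
    (z := L / (w - c)) :
  w != c -> P * w ^+ 3 - a * w + b = 0 ->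
  z ^+ 3 + (3%:R * P * c ^+ 2 - a) * z ^+ 2 + P * (3%:R * c * L) * z + P * L ^+ 2 = 0.
Proof.
move=> wc E; have u0 : w - c != 0 by rewrite subr_eq0.
apply: (mulIf (expf_neq0 3 u0)); rewrite mul0r.
have -> : (z ^+ 3 + (3%:R * P * c ^+ 2 - a) * z ^+ 2 + P * (3%:R * c * L) * z + P * L ^+ 2)
    * (w - c) ^+ 3 = L ^+ 2 * (P * w ^+ 3 - a * w + b).
  by rewrite /z /L; field.
by rewrite E mulr0.
Qed.

(** Inverting y moves the coefficient B to the leading place; the factor B in z makes
    the equation monic. *)
Lemma reciprocal_cubic (F : fieldType) (y P A B : F) m :
  y != 0 -> P != 0 -> y ^+ 3 - A / P ^+ (2 * m) * y + B / P ^+ (3 * m + 1) = 0 ->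
  let z := B / (y * P ^+ m) in
  z ^+ 3 + (- (P * A)) * z ^+ 2 + P * B ^+ 2 = 0.
Proof.
move=> y0 P0 E z; have Pm : P ^+ m != 0 by rewrite expf_neq0.
have yP : y * P ^+ m != 0 by rewrite mulf_neq0.
apply: (mulIf (expf_neq0 3 yP)); rewrite mul0r.
rewrite exprD ![(_ * m)%N]mulnC !exprM expr1 in E.
have -> : (z ^+ 3 + (- (P * A)) * z ^+ 2 + P * B ^+ 2) * (y * P ^+ m) ^+ 3 =
   B ^+ 2 * P * (P ^+ m) ^+ 3 * (y ^+ 3 - A / (P ^+ m) ^+ 2 * y + B / ((P ^+ m) ^+ 3 * P)).
  by rewrite /z; field; rewrite ?P0 ?y0 ?Pm.
by rewrite E mulr0.
Qed.

Lemma scaled_cubic (F : fieldType) (y P A B : F) m :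
  P != 0 -> y ^+ 3 - A / P ^+ (2 * m) * y + B / P ^+ (3 * m) = 0 ->
  let z := y * P ^+ m in z ^+ 3 - A * z + B = 0.
Proof.
move=> P0 E z; have Pm : P ^+ m != 0 by rewrite expf_neq0.
rewrite ![(_ * m)%N]mulnC !exprM in E.
have -> : z ^+ 3 - A * z + B =
   (P ^+ m) ^+ 3 * (y ^+ 3 - A / (P ^+ m) ^+ 2 * y + B / (P ^+ m) ^+ 3).
  by rewrite /z; field; rewrite ?P0 ?Pm.
by rewrite E mulr0.
Qed.

Lemma scaled_cubic_polar (F : fieldType) (y P A B : F) m :
  P != 0 -> y ^+ 3 - A / P ^+ (2 * m + 1) * y + B / P ^+ (3 * m + 1) = 0 ->
  let z := y * P ^+ m in P * z ^+ 3 - A * z + B = 0.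
Proof.
move=> P0 E z; have Pm : P ^+ m != 0 by rewrite expf_neq0.
rewrite (exprD P (2 * m)) (exprD P (3 * m)) ![(_ * m)%N]mulnC !exprM expr1 in E.
have -> : P * z ^+ 3 - A * z + B =
   (P ^+ m) ^+ 3 * P * (y ^+ 3 - A / ((P ^+ m) ^+ 2 * P) * y + B / ((P ^+ m) ^+ 3 * P)).
  by rewrite /z; field; rewrite ?P0 ?Pm.
by rewrite E mulr0.
Qed.

Section CubicPolynomial.
Variable k : fieldType.

Lemma cubic_monic (a b : k) : cubic a b \is monic.
Proof.
rewrite /cubic -addrA monicE lead_coefDl ?lead_coefXn // size_polyXn ltnS.
apply/leq_sizeP => j j3.
by rewrite coefD coefN coefZ coefX coefC; case: j j3 => [|[|[|j]]] // _; rewrite mulr0 oppr0 addr0.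
Qed.

Lemma size_cubic (a b : k) : size (cubic a b) = 4%N.
Proof.
rewrite /cubic -addrA size_polyDl ?size_polyXn // ltnS.
apply/leq_sizeP => j j3.
by rewrite coefD coefN coefZ coefX coefC; case: j j3 => [|[|[|j]]] // _; rewrite mulr0 oppr0 addr0.
Qed.

Lemma horner_cubic (a b t : k) : (cubic a b).[t] = t ^+ 3 - a * t + b.
Proof. by rewrite /cubic !hornerE. Qed.

End CubicPolynomial.

Section CubicFields.
Variables (k K : fieldType) (tf : {rmorphism {poly k} -> K}).
Hypothesis tf_inj : injective tf.
Hypothesis tf_div : forall z, exists n d : {poly k}, d != 0 /\ z = tf n / tf d.
Variable (F : fieldExtType K).
Hypothesis dimF : \dim {: F} = 3%N.

Local Notation sgn := (signature (cstK tf) F (max_ideal (O_inf tf))).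
Local Notation inF := (inF tf F).

Definition generic_cubic (p q r : {poly k}) : {poly {poly k}} :=
  'X^3 + (p%:P * 'X^2 + q%:P * 'X + r%:P).

Section Generator.
Variables (theta : F) (p q r : {poly k}).
Hypothesis theta_gen : <<1%VS; theta>>%VS = fullv.
Hypothesis theta_root : theta ^+ 3 + inF p * theta ^+ 2 + inF q * theta + inF r = 0.

Local Notation Phi := (generic_cubic p q r).

Lemma generic_cubic_low : (size (p%:P * 'X^2 + q%:P * 'X + r%:P : {poly {poly k}})%R < size ('X^3 : {poly {poly k}}))%N.
Proof.
rewrite size_polyXn ltnS; apply/leq_sizeP => j j3.
by rewrite !coefD !coefCM coefXn coefX coefC; case: j j3 => [|[|[|j]]] // _; rewrite !mulr0 !addr0.
Qed.

Lemma size_generic_cubic : size Phi = (\dim {: F}).+1.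
Proof. by rewrite dimF size_polyDl ?generic_cubic_low // size_polyXn. Qed.

Lemma monic_generic_cubic : Phi \is monic.
Proof. by rewrite monicE lead_coefDl ?generic_cubic_low // lead_coefXn. Qed.

Lemma root_generic_cubic : eval_at tf theta Phi = 0.
Proof.
have evXn n : eval_at tf theta 'X^n = theta ^+ n by rewrite rmorphXn evX.
have evM g u : eval_at tf theta (g%:P * u) = inF g * eval_at tf theta u.
  by rewrite rmorphM evC.
rewrite -[RHS]theta_root 3!rmorphD evXn 2!evM evXn evX evC.
by rewrite addrA addrA.
Qed.

Lemma red_generic_cubic : red k Phi = 'X^3 + (p.[0] *: 'X^2 + q.[0] *: 'X + (r.[0])%:P).
Proof. have redXn n : red k 'X^n = 'X^n by rewrite rmorphXn redX.
have redM g u : red k (g%:P * u) = g.[0] *: red k u by rewrite rmorphM redC mul_polyC.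
by rewrite 3!rmorphD redXn 2!redM redXn redX redC. Qed.

(** The reduction is T^3, and Phi = T^3 + pi S where S has the constant term r',
    prime to T. *)
Lemma signature_eisenstein p' q' r' : p = 'X * p' -> q = 'X * q' -> r = 'X * r' ->
  r'.[0] != 0 -> sgn = [:: 3; 1]%N.
Proof.
move=> pE qE rE r0; have irrX : irreducible_poly ('X : {poly k}).
  by rewrite -['X]subr0; apply: irredp_XsubC.
rewrite (signature_inf tf_inj tf_div monic_generic_cubic root_generic_cubic theta_gen size_generic_cubic
  (s := [:: ('X, 3%N)])) //.
- by rewrite /= /factor_ef size_polyX.
- by move=> i; rewrite inE => /eqP ->.
- by move=> i; rewrite inE => /eqP ->; apply: monicX.
- by move=> i; rewrite inE => /eqP ->.
- move=> i; rewrite inE => /eqP -> /=.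
  exists 'X, 1, (p'%:P * 'X^2 + q'%:P * 'X + r'%:P); split.
  + by rewrite /generic_cubic pE qE rE !polyCM mulr1 !mulrDr !mulrA.
  + exact: redX.
  + by rewrite rmorph1; apply: irred_ndvd1.
  right; rewrite -[X in X %| _]subr0 dvdp_XsubCl /root.
  have rPX n : red k 'X^n = 'X^n by rewrite rmorphXn redX.
  have rM g u : red k (g%:P * u) = (g.[0])%:P * red k u by rewrite rmorphM redC.
  by rewrite 2!rmorphD 2!rM rPX redX redC !(hornerD, hornerCM, hornerC, hornerXn, hornerX) expr0n !mulr0 !add0r.
- have X0 (g : {poly k}) : ('X * g).[0] = 0 by rewrite hornerM hornerX mul0r.
  rewrite big_seq1 red_generic_cubic pE qE rE !X0 !scale0r !add0r addr0.
  exact: dvdpp.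
Qed.

(** The reduction is T^2 (T + p(0)), and Phi = T^2 (T + p) + pi (q' T + r') satisfies
    Dedekind's criterion at T because r' does not vanish at pi = 0. *)
Lemma signature_double_root q' r' : q = 'X * q' -> r = 'X * r' ->
  p.[0] != 0 -> r'.[0] != 0 -> sgn = [:: 1; 1; 2; 1]%N.
Proof.
move=> qE rE p0 r0.
have irrX : irreducible_poly ('X : {poly k}).
  by rewrite -['X]subr0; apply: irredp_XsubC.
have irrXp : irreducible_poly ('X + (p.[0])%:P) by apply: irredp_XaddC.
have PhiE : Phi = 'X ^+ 2 * ('X + p%:P) + 'X%:P * (q'%:P * 'X + r'%:P).
  rewrite /generic_cubic qE rE !polyCM.
  by move: p%:P q'%:P r'%:P 'X%:P => P Q R X; ring.
have rPhi : red k Phi = ('X + (p.[0])%:P) * 'X^2.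
  have X0 (g : {poly k}) : ('X * g).[0] = 0 by rewrite hornerM hornerX mul0r.
  rewrite red_generic_cubic qE rE !X0 !scale0r !addr0 mulrDl -exprS.
  by rewrite mul_polyC.
have Xroot (u : {poly k}) : ('X %| u) = root u 0 by rewrite -dvdp_XsubCl subr0.
rewrite (signature_inf tf_inj tf_div monic_generic_cubic root_generic_cubic theta_gen size_generic_cubic
  (s := [:: ('X + (p.[0])%:P, 1%N); ('X, 2%N)])) //.
- by rewrite /= /factor_ef size_polyX size_XaddC.
- by move=> i; rewrite !inE => /orP[]/eqP ->.
- by move=> i; rewrite !inE => /orP[]/eqP ->; rewrite ?monicX ?monicXaddC.
- by move=> i; rewrite !inE => /orP[]/eqP ->.
- move=> i; rewrite !inE => /orP[]/eqP -> /=.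
    apply: (regular_simple rPhi); apply: irred_ndvdX => //.
    rewrite -[p.[0]]opprK polyCN dvdp_XsubCl /root !hornerE oppr_eq0 //.
  exists 'X, ('X + p%:P), (q'%:P * 'X + r'%:P); split=> //.
  + exact: redX.
  + by rewrite rmorphD redX redC Xroot /root !hornerE.
  right; rewrite Xroot rmorphD rmorphM redX !redC /root.
  by rewrite !(hornerD, hornerCM, hornerC, hornerX) mulr0 add0r.
- rewrite /= andbT inE; apply/eqP => /(congr1 (fun u : {poly k} => u.[0])) /eqP.
  by rewrite !hornerE (negPf p0).
- by rewrite rPhi !big_cons big_nil mulr1 expr1.
Qed.

End Generator.

Section Depressed.
Variables (w : F) (al be : {poly k}).
Hypothesis w_gen : <<1%VS; w>>%VS = fullv.
Hypothesis w_root : w ^+ 3 - inF al * w + inF be = 0.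
Local Notation f := (cubic al.[0] be.[0]).

Let signature_squarefree (Gs : seq {poly k}) :
  (forall G, G \in Gs -> irreducible_poly G) -> (forall G, G \in Gs -> G \is monic) ->
  uniq Gs -> f = \prod_(G <- Gs) G ->
  sgn = flatten [seq [:: ef.1; ef.2] | ef <-
    sort (fun e f : nat *l nat => (e <= f)%O) [seq (1%N, (size (G : {poly k})).-1) | G <- Gs]].
Proof.
move=> irr mon uGs E.
have w_root' : w ^+ 3 + inF 0 * w ^+ 2 + inF (- al) * w + inF be = 0.
  by rewrite rmorph0 mul0r addr0 rmorphN mulNr.
apply: (signature_inf_squarefree tf_inj tf_div (monic_generic_cubic 0 (- al) be) (root_generic_cubic w_root')
  w_gen (size_generic_cubic 0 (- al) be)) => //.
by rewrite (red_generic_cubic 0 (- al) be) -E /cubic hornerN horner0 scale0r add0r scaleNr addrA.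
Qed.

Lemma signature_split rs : uniq rs -> size rs = 3%N -> all (root f) rs ->
  sgn = [:: 1; 1; 1; 1; 1; 1]%N.
Proof.
move=> urs srs frs; rewrite (@signature_squarefree [seq 'X - c%:P | c <- rs]) -?map_comp.
- by case: rs srs {urs frs} => [|a [|b [|c []]]] //= _; rewrite !size_XsubC.
- by move=> _ /mapP[c _ ->]; apply: irredp_XsubC.
- by move=> _ /mapP[c _ ->]; apply: monicXsubC.
- by rewrite map_inj_uniq // => a b /addrI/oppr_inj/polyC_inj.
rewrite big_map {1}(@all_roots_prod_XsubC _ f rs) ?size_cubic ?srs ?uniq_rootsE //.
by rewrite (monicP (cubic_monic _ _)) scale1r.
Qed.

Lemma signature_inert : (forall t, ~~ root f t) -> sgn = [:: 1; 3]%N.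
Proof.
move=> nr; rewrite (@signature_squarefree [:: f]) ?big_seq1 //=.
- by rewrite size_cubic.
- by move=> G; rewrite inE => /eqP->; apply: cubic_irreducible => //; rewrite size_cubic.
- by move=> G; rewrite inE => /eqP->; apply: cubic_monic.
Qed.

(** The cofactor of T - t has no root but possibly t. A double root t would satisfy
    3 t^2 = a, that is t^2 = a in characteristic 2, whence b = 0. *)
Lemma signature_mixed t : 2%N \in [pchar k] -> be.[0] != 0 -> root f t ->
  (forall t', root f t' -> t' = t) -> sgn = [:: 1; 1; 1; 2]%N.
Proof.
move=> char2 b0 ft ft'; set a := al.[0] in ft ft' *; set b := be.[0] in b0 ft ft' *.
pose g : {poly k} := 'X^2 + (t *: 'X + (t ^+ 2 - a)%:P).
have sg0 : (size (t *: 'X + (t ^+ 2 - a)%:P)%R < size ('X^2 : {poly k}))%N.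
  rewrite size_polyXn ltnS; apply/leq_sizeP => j j2.
  by rewrite coefD coefZ coefX coefC; case: j j2 => [|[|j]] // _; rewrite mulr0 addr0.
have sg : size g = 3%N by rewrite size_polyDl // size_polyXn.
have mg : g \is monic by rewrite monicE lead_coefDl // lead_coefXn.
have tE : t ^+ 3 - a * t + b = 0 by rewrite -horner_cubic; apply/rootP.
have fE : cubic a b = ('X - t%:P) * g.
  have -> : b = a * t - t ^+ 3 by apply/eqP; rewrite -subr_eq0 -tE; apply/eqP; ring.
  rewrite /cubic /g -!mul_polyC !polyCB !polyC_exp polyCM; ring.
have gt' t' : ~~ root g t'.
  apply/negP => gt'; have t't : t' = t by apply: ft'; rewrite fE rootM gt' orbT.
  have gtE : g.[t] = t ^+ 2 + (t * t + (t ^+ 2 - a)).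
    by rewrite /g !(hornerD, hornerZ, hornerC, hornerXn, hornerX).
  have two0 : 2%:R = 0 :> k by apply: pcharf0.
  case/eqP: b0; have -> : b = - (t * (t ^+ 2 + (t * t + (t ^+ 2 - a)))) + 2%:R * t ^+ 3.
    by apply/eqP; rewrite -subr_eq0 -tE; apply/eqP; ring.
  by move/rootP: gt'; rewrite two0 mul0r addr0 t't gtE => ->; rewrite mulr0 oppr0.
have irrg : irreducible_poly g by apply: cubic_irreducible; rewrite ?sg.
rewrite (@signature_squarefree [:: 'X - t%:P; g]).
- by rewrite /= size_XsubC sg.
- by move=> G; rewrite !inE => /orP[]/eqP->; [apply: irredp_XsubC|].
- by move=> G; rewrite !inE => /orP[]/eqP->; [apply: monicXsubC|].
- rewrite /= inE andbT; apply/eqP => /(congr1 (fun u : {poly k} => size u)).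
  by rewrite size_XsubC sg.
by rewrite !big_cons big_nil mulr1.
Qed.

End Depressed.
End CubicFields.

(** * Integral generators of a cubic function field *)

Section CubicInfinity.
Variables (k K : fieldType) (tf : {rmorphism {poly k} -> K}).
Hypothesis tf_inj : injective tf.
Hypothesis tf_div : forall z, exists n d : {poly k}, d != 0 /\ z = tf n / tf d.
Variables (F : fieldExtType K) (A B : {poly k}) (y : F).
Hypothesis irrAB : irreducible_poly (cubic (tf A) (tf B)).
Hypothesis y_root : root (map_poly (in_alg F) (cubic (tf A) (tf B))) y.
Hypothesis y_gen : <<1%VS; y>>%VS = fullv.

Local Notation sgn := (signature (cstK tf) F (max_ideal (O_inf tf))).
Local Notation inF := (inF tf F).
Local Notation P := (inF 'X).

(** The minimal polynomial of y is a nonconstant divisor of the irreducible cubic. *)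
Lemma dim_cubic : \dim {: F} = 3%N.
Proof.
have /polyOver1P[m mE] := minPolyOver 1 y.
have := size_minPoly 1 y; rewrite mE size_map_poly => sm.
have m_dvd : m %| cubic (tf A) (tf B).
  rewrite -(dvdp_map (in_alg F)) -mE; apply: minPoly_dvdp => //.
  by apply/polyOver1P; exists (cubic (tf A) (tf B)).
have := dim_Fadjoin 1 y; rewrite y_gen dimv1 muln1 => ->.
have : m %= cubic (tf A) (tf B).
  apply: irrAB => //; apply/eqP => s1; rewrite s1 in sm.
  by case: sm.
by move/eqp_size; rewrite size_cubic sm => /succn_inj.
Qed.

Lemma y_cubic : y ^+ 3 - (tf A)%:A * y + (tf B)%:A = 0.
Proof.
have /rootP := y_root; rewrite /cubic rmorphD rmorphB /= map_polyXn map_polyZ map_polyX map_polyC.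
by rewrite !(hornerD, hornerN, hornerZ, hornerC, hornerXn, hornerX).
Qed.

Lemma B_neq0 : B != 0.
Proof.
apply/eqP => B0; have := irrAB; rewrite B0 rmorph0.
have dvdX : 'X %| cubic (tf A) 0 by rewrite -['X]subr0 dvdp_XsubCl /root horner_cubic expr0n mulr0 subr0 addr0.
case=> _ /(_ 'X); rewrite size_polyX => /(_ isT dvdX)/eqp_size.
by rewrite size_cubic size_polyX.
Qed.

Lemma y_notin_base (c : K) : y != c%:A.
Proof.
apply/eqP => yc; have := dim_cubic; rewrite -y_gen.
have /Fadjoin_idP -> : y \in 1%AS by rewrite yc memvZ // mem1v.
by rewrite dimv1.
Qed.

Lemma y_neq0 : y != 0.
Proof. by have := y_notin_base 0; rewrite scale0r. Qed.

Lemma inFX_neq0 : P != 0.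
Proof. by rewrite inF_eq0 // polyX_eq0. Qed.

Lemma inF_rev N (p : {poly k}) : (size p <= N.+1)%N ->
  (tf p)%:A = inF (rev_poly N p) / P ^+ N.
Proof.
move=> sp; rewrite -rmorphXn -fmorph_div /=; congr (_%:A).
rewrite rmorphXn at_inv_revE // at_invX exprVn invrK divfK //.
by rewrite expf_neq0 // tfX_neq0.
Qed.

Lemma rev_poly0 N (p : {poly k}) : (rev_poly N p).[0] = p`_N.
Proof. by rewrite horner_coef0 coef_poly /= subn0. Qed.

Lemma rev_polyS N (p : {poly k}) : (size p <= N.+1)%N ->
  rev_poly N.+1 p = 'X * rev_poly N p.
Proof.
move=> sp; apply/polyP => -[|i]; rewrite coefXM !coef_poly //=.
by rewrite subn0 nth_default.
Qed.

Lemma generator_change (z : F) : y \in <<1%VS; z>>%VS -> <<1%VS; z>>%VS = fullv.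
Proof.
move=> yz; apply/eqP; rewrite eqEsubv subvf -y_gen /=.
by apply/FadjoinP; split; rewrite ?subv_adjoin.
Qed.

Lemma mem_inF (E : {subfield F}) p : inF p \in E.
Proof. by rewrite memvZ // mem1v. Qed.

(** Take w = y / x^m. *)
Lemma depressed_generator m : (size A <= (2 * m).+1)%N -> (size B <= (3 * m).+1)%N ->
  exists w al be, [/\ <<1%VS; w>>%VS = fullv, w ^+ 3 - inF al * w + inF be = 0,
    al.[0] = A`_(2 * m) & be.[0] = B`_(3 * m)].
Proof.
move=> sA sB; have := y_cubic; rewrite (inF_rev sA) (inF_rev sB).
move/(scaled_cubic inFX_neq0) => E.
exists (y * P ^+ m), (rev_poly (2 * m) A), (rev_poly (3 * m) B); split; rewrite ?rev_poly0 //.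
apply: generator_change; set z := y * _.
have -> : y = z / P ^+ m by rewrite mulfK // expf_neq0 // inFX_neq0.
by apply: rpredM; rewrite ?memv_adjoin // rpredV rpredX // mem_inF.
Qed.

(** Here n0 = 3 m + 1, and y has valuation - m - 1/3 relative to pi. The element
    b / (y pi^m), with b a unit, has valuation 1/3. *)
Lemma signature_total1 m : (size A <= (2 * m).+1)%N -> size B = (3 * m).+2 ->
  sgn = [:: 3; 1]%N.
Proof.
move=> sA sB; have sB' : (size B <= (3 * m + 1).+1)%N by rewrite sB addn1.
have := y_cubic; rewrite (inF_rev sA) (inF_rev sB').
set a := rev_poly _ A; set b := rev_poly _ B.
have b0 : b.[0] != 0.
  by have := B_neq0; rewrite rev_poly0 -lead_coef_eq0 lead_coefE sB addn1.
move/(reciprocal_cubic y_neq0 inFX_neq0); set z := _ / _ => /= E.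
have z_gen : <<1%VS; z>>%VS = fullv.
  apply: generator_change.
  have -> : y = inF b / (z * P ^+ m).
    have bF : inF b != 0 by rewrite inF_eq0 //; apply: contraNneq b0 => ->; rewrite horner0.
    have := expf_neq0 m inFX_neq0; have := y_neq0; rewrite /z => y0 Pm.
    by field; rewrite y0 Pm bF.
  by apply: rpredM; rewrite ?mem_inF // rpredV rpredM ?memv_adjoin // rpredX // mem_inF.
have root_z : z ^+ 3 + inF ('X * - a) * z ^+ 2 + inF ('X * 0) * z + inF ('X * b ^+ 2) = 0.
  by rewrite mulr0 rmorph0 mul0r addr0 mulrN rmorphN 2!rmorphM rmorphXn.
apply: (signature_eisenstein tf_inj tf_div dim_cubic z_gen root_z) => //.
by rewrite horner_exp expf_neq0.
Qed.

(** Here n0 = 3 m + 2, and y / x^(m+1) has valuation 1/3 relative to pi. *)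
Lemma signature_total2 m : (size A <= (2 * m).+2)%N -> size B = (3 * m).+3 ->
  sgn = [:: 3; 1]%N.
Proof.
move=> sA sB.
have sA' : (size A <= (2 * m.+1).+1)%N by apply: leq_trans sA _; lia.
have sB' : (size B <= (3 * m.+1).+1)%N by rewrite sB; lia.
have := y_cubic; rewrite (inF_rev sA') (inF_rev sB').
move/(scaled_cubic inFX_neq0); set w := y * _ => /=.
have -> : (2 * m.+1 = (2 * m).+2)%N by lia.
have -> : (3 * m.+1 = (3 * m).+3)%N by lia.
have sB'' : (size B <= (3 * m).+3)%N by rewrite sB.
rewrite (rev_polyS sA) (rev_polyS sB'') => E.
set a := rev_poly _ A in E; set b := rev_poly _ B in E.
have b0 : b.[0] != 0.
  by have := B_neq0; rewrite rev_poly0 -lead_coef_eq0 lead_coefE sB.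
have w_gen : <<1%VS; w>>%VS = fullv.
  apply: generator_change; have -> : y = w / P ^+ m.+1 by rewrite mulfK // expf_neq0 // inFX_neq0.
  by apply: rpredM; rewrite ?memv_adjoin // rpredV rpredX // mem_inF.
have root_w : w ^+ 3 + inF ('X * 0) * w ^+ 2 + inF ('X * - a) * w + inF ('X * b) = 0.
  by rewrite mulr0 rmorph0 mul0r addr0 mulrN rmorphN mulNr.
exact: (signature_eisenstein tf_inj tf_div dim_cubic w_gen root_w).
Qed.

(** The point c is chosen off the simple root of the reduced equation for
    w = y / x^m, so that l is a unit at infinity. *)
Lemma signature_partial m : size A = (2 * m).+2 -> (size B <= (3 * m).+2)%N ->
  sgn = [:: 1; 1; 2; 1]%N.
Proof.
move=> sA sB.
have sA' : (size A <= (2 * m + 1).+1)%N by rewrite sA addn1.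
have sB' : (size B <= (3 * m + 1).+1)%N by rewrite addn1.
have := y_cubic; rewrite (inF_rev sA') (inF_rev sB').
set a := rev_poly _ A; set b := rev_poly _ B.
have a0 : a.[0] != 0.
  have A0 : A != 0 by rewrite -size_poly_eq0 sA.
  by rewrite rev_poly0 addn1; move: A0; rewrite -lead_coef_eq0 lead_coefE sA.
move/(scaled_cubic_polar inFX_neq0); set w := y * _ => /= E.
have [c c0] : exists c : k, b.[0] - a.[0] * c != 0.
  have [b0|b0] := eqVneq b.[0] 0; [exists 1|exists 0]; rewrite ?mulr0 ?subr0 //.
  by rewrite b0 sub0r mulr1 oppr_eq0.
pose l := 'X * c%:P ^+ 3 - a * c%:P + b.
have l0 : l.[0] != 0.
  by rewrite !(hornerD, hornerN, hornerM, hornerC, hornerX) mul0r add0r addrC.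
have lF : inF l != 0 by rewrite inF_eq0 //; apply: contraNneq l0 => ->; rewrite horner0.
have wc : w != inF c%:P.
  apply: contraNneq (y_notin_base (at_inv tf c%:P / at_inv tf 'X ^+ m)) => wc.
  rewrite -[_%:A]/(in_alg F _) fmorph_div rmorphXn /=.
  by rewrite -[(at_inv tf c%:P)%:A]wc mulfK // expf_neq0 // inFX_neq0.
have := moebius_cubic wc E.
have lE : P * inF c%:P ^+ 3 - inF a * inF c%:P + inF b = inF l.
  by rewrite -rmorphXn -2!rmorphM -rmorphB -rmorphD.
rewrite lE; set z := _ / _ => Ez.
have z_gen : <<1%VS; z>>%VS = fullv.
  apply: generator_change.
  have -> : y = (inF c%:P + inF l / z) / P ^+ m.
    have -> : inF l / z = w - inF c%:P by rewrite /z invf_div mulrCA divff // mulr1.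
    by rewrite addrCA subrr addr0 mulfK // expf_neq0 // inFX_neq0.
  by rewrite rpredM ?rpredV ?rpredX ?mem_inF // rpredD ?mem_inF // rpredM ?rpredV ?mem_inF ?memv_adjoin.
have root_z : z ^+ 3 + inF (3%:R * 'X * c%:P ^+ 2 - a) * z ^+ 2 +
    inF ('X * (3%:R * c%:P * l)) * z + inF ('X * l ^+ 2) = 0.
  have -> : inF (3%:R * 'X * c%:P ^+ 2 - a) = 3%:R * P * inF c%:P ^+ 2 - inF a.
    by rewrite -rmorphXn -(rmorph_nat inF 3) -2!rmorphM -rmorphB.
  have -> : inF ('X * (3%:R * c%:P * l)) = P * (3%:R * inF c%:P * inF l).
    by rewrite -(rmorph_nat inF 3) -3!rmorphM.
  by rewrite -[RHS]Ez -[inF l ^+ 2]rmorphXn -[P * inF (l ^+ 2)]rmorphM.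
apply: (signature_double_root tf_inj tf_div dim_cubic z_gen root_z) => //.
  by rewrite !(hornerD, hornerN, hornerM, hornerX) mulr0 mul0r sub0r oppr_eq0.
by rewrite horner_exp expf_neq0.
Qed.

End CubicInfinity.

(** * Pure cubics over a finite field *)

Section PureCubic.
Variable k : finFieldType.
Hypothesis char2 : 2%N \in [pchar k].

Lemma root_pure_cubic (b t : k) : root (cubic 0 b) t = (t ^+ 3 == b).
Proof. by rewrite /root horner_cubic mul0r subr0 addr_eq0 oppr_pchar2. Qed.

(** With q = 3 j + 1, the j-th power of some nonzero element differs from 1, because
    T^j - 1 has at most j < q - 1 roots. *)
Lemma exists_cube_root1 : (#|k| = 1 %[mod 3])%N -> exists2 z : k, z != 1 & z ^+ 3 = 1.
Proof.
move=> q1; pose j := (#|k|.-1 %/ 3)%N.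
have k1 := finNzRing_gt1 k; have jE : (j * 3 = #|k|.-1)%N by rewrite /j; lia.
have [/existsP[g /andP[g0 gj]]|] := boolP [exists g : k, (g != 0) && (g ^+ j != 1)].
  by exists (g ^+ j) => //; rewrite -exprM jE; apply: (mulfI g0); rewrite -exprS mulr1 prednK ?expf_card //; lia.
rewrite negb_exists => /forallP H; exfalso.
have j0 : (0 < j)%N.
  by move: k1; rewrite -subn_gt0 subn1 -jE; case: (j).
pose rs := enum [pred g : k | g != 0].
have : (size rs < size ('X^j - 1%:P : {poly k})%R)%N.
  apply: max_poly_roots; first by rewrite -size_poly_eq0 size_XnsubC.
    apply/allP => g; rewrite mem_enum inE => g0; rewrite /root !hornerE subr_eq0.
    by have := H g; rewrite g0 /= negbK.
  exact: enum_uniq.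
rewrite size_XnsubC // -cardE; have := cardC1 (0 : k).
rewrite (eq_card (B := [pred g : k | g != 0])) => [->|g]; last by rewrite !inE.
by rewrite -jE; move: (j) j0 => i; lia.
Qed.

Lemma pure_cubic_split (b c : k) : b != 0 -> b = c ^+ 3 -> (#|k| = 1 %[mod 3])%N ->
  exists rs, [/\ uniq rs, size rs = 3%N & all (root (cubic 0 b)) rs].
Proof.
move=> b0 bE /exists_cube_root1[z z1 z3].
have c0 : c != 0 by apply: contraNneq b0 => c0; rewrite bE c0 expr0n.
have z0 : z != 0 by apply: contra_eq_neq z3 => ->; rewrite expr0n /= eq_sym oner_eq0.
have z2 : z ^+ 2 != 1 by apply: contra_neq z1 => z2; rewrite -z3 exprS z2 mulr1.
have zz2 : z != z ^+ 2.
  by apply: contra_neq z1 => zz2; apply: (mulfI z0); rewrite mulr1 -expr2.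
exists [seq c * v | v <- [:: 1; z; z ^+ 2]]; split=> //.
  by rewrite (map_inj_uniq (mulfI c0)) /= !inE negb_or ![1 == _]eq_sym z1 z2 zz2.
have root_cv v : v ^+ 3 = 1 -> root (cubic 0 b) (c * v).
  by move=> v3; rewrite root_pure_cubic bE exprMn v3 mulr1.
have z23 : (z ^+ 2) ^+ 3 = 1 by rewrite exprAC z3 expr1n.
by rewrite /= !root_cv ?expr1n.
Qed.

(** A ratio u of two cube roots satisfies u^3 = 1 and u = u^q = u^2. *)
Lemma pure_cubic_mixed (b c : k) : b != 0 -> b = c ^+ 3 -> (#|k| = 2 %[mod 3])%N ->
  root (cubic 0 b) c /\ forall t, root (cubic 0 b) t -> t = c.
Proof.
move=> b0 bE q2; have c0 : c != 0 by apply: contraNneq b0 => c0; rewrite bE c0 expr0n.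
split=> [|t]; rewrite root_pure_cubic bE // => /eqP tc.
pose u := t / c; have u3 : u ^+ 3 = 1.
  by rewrite expr_div_n tc divff // expf_neq0.
have u1 : u = u ^+ 2.
  rewrite -{1}(expf_card u) {1}(divn_eq #|k| 3) q2 exprD mulnC exprM u3 expr1n mul1r //.
have u0 : u != 0 by apply: contra_eq_neq u3 => ->; rewrite expr0n /= eq_sym oner_eq0.
have : u = 1 by apply: (mulfI u0); rewrite mulr1 -expr2.
by move/(congr1 (fun v => v * c)); rewrite mul1r divfK.
Qed.

Lemma pure_cubic_inert (b : k) : ~ (exists c, b = c ^+ 3) -> forall t, ~~ root (cubic 0 b) t.
Proof. by move=> nb t; apply/negP; rewrite root_pure_cubic => /eqP E; apply: nb; exists t. Qed.

End PureCubic.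

(** * Comparison of degrees *)

Section Degrees.
Variables (R : nzRingType) (A B : {poly R}).
Hypothesis B0 : B != 0.

Lemma fine_deg (p : {poly R}) : p != 0 -> fine (deg p) = (size p).-1.
Proof. by rewrite /deg => /negPf->. Qed.

Lemma deg_lt : (3%:E * deg A < 2%:E * deg B)%E ->
  size A = 0%N \/ (3 * (size A).-1 < 2 * (size B).-1)%N.
Proof.
rewrite /deg (negPf B0); have [->|A0] := eqVneq A 0; first by left; rewrite size_poly0.
by rewrite -!EFinM lte_fin => H; right; lia.
Qed.

Lemma deg_gt : (2%:E * deg B < 3%:E * deg A)%E ->
  A != 0 /\ (2 * (size B).-1 < 3 * (size A).-1)%N.
Proof.
rewrite /deg (negPf B0); have [A0|A0] := eqVneq A 0.
  by rewrite gt0_muleNy ?lte_fin // ltNge leNye.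
by rewrite -!EFinM lte_fin => H; split=> //; lia.
Qed.

Lemma deg_eq : (3%:E * deg A = 2%:E * deg B)%E ->
  A != 0 /\ (3 * (size A).-1 = 2 * (size B).-1)%N.
Proof.
rewrite /deg (negPf B0); have [A0|A0] := eqVneq A 0.
  by rewrite gt0_muleNy ?lte_fin.
by rewrite -!EFinM => -[H]; split=> //; lia.
Qed.

End Degrees.

Lemma modz3_0 (n : nat) : (n%:Z = 0 %[mod 3])%Z -> exists m, n = (3 * m)%N.
Proof. by move=> H; exists (n %/ 3)%N; lia. Qed.

Lemma modz3_neq0 (n : nat) : (n%:Z <> 0 %[mod 3])%Z ->
  exists m, n = (3 * m).+1 \/ n = (3 * m).+2.
Proof. by move=> H; exists (n %/ 3)%N; lia. Qed.

Lemma modz2_1 (n : nat) : (n%:Z = 1 %[mod 2])%Z -> exists m, n = (2 * m).+1.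
Proof. by move=> H; exists (n %/ 2)%N; lia. Qed.

Lemma modz3_1 (n : nat) : (n%:Z = 1 %[mod 3])%Z -> (n = 1 %[mod 3])%N.
Proof. by lia. Qed.

Lemma modz3_N1 (n : nat) : (n%:Z = -1 %[mod 3])%Z -> (n = 2 %[mod 3])%N.
Proof. by rewrite (_ : (-1 %% 3)%Z = 2) //; lia. Qed.

Lemma triple_eq_double (i j : nat) : (3 * i = 2 * j)%N ->
  exists m, i = (2 * m)%N /\ j = (3 * m)%N.
Proof. by move=> H; exists (j %/ 3)%N; lia. Qed.

Lemma size_bound (s n N : nat) : (forall j, 3 * j < 2 * n -> j <= N)%N ->
  s = 0%N \/ (3 * s.-1 < 2 * n)%N -> (s <= N.+1)%N.
Proof. by move=> H [->//|/H]; case: s. Qed.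

(** * The signature *)

Theorem theorem2p1p5 (Fq : finFieldType) (charFq : 2%N \in [pchar Fq])
    (F : fieldExtType (ratfun Fq)) (A B : {poly Fq}) (y : F)
    (AB_standard : standard_form A B y) :
  let q := #|Fq| in
  let n1 := deg A in
  let n0 := deg B in
  let a := lead_coef A in
  let b := lead_coef B in
  let sgn := signature (@cst_ratfun Fq) F (@infinite_place Fq) in
  [/\ ([/\ (3%:E * n1 < 2%:E * n0)%E, (fine n0 = 0 %[mod 3])%Z,
           exists c : Fq, b = c ^+ 3 & (q%:Z = 1 %[mod 3])%Z]
       \/ ((3%:E * n1 = 2%:E * n0)%E
           /\ #|[pred t : Fq | root (cubic a b) t]| = 3%N)) ->
        sgn = [:: 1; 1; 1; 1; 1; 1]%N,
      ((2%:E * n0 < 3%:E * n1)%E /\ (fine n1 = 1 %[mod 2])%Z) ->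
        sgn = [:: 1; 1; 2; 1]%N,
      ([/\ (3%:E * n1 < 2%:E * n0)%E, (fine n0 = 0 %[mod 3])%Z,
           exists c : Fq, b = c ^+ 3 & (q%:Z = -1 %[mod 3])%Z]
       \/ ((3%:E * n1 = 2%:E * n0)%E
           /\ #|[pred t : Fq | root (cubic a b) t]| = 1%N)) ->
        sgn = [:: 1; 1; 1; 2]%N,
      ((3%:E * n1 < 2%:E * n0)%E /\ (fine n0 <> 0 %[mod 3])%Z) ->
        sgn = [:: 3; 1]%N
    & ([/\ (3%:E * n1 < 2%:E * n0)%E, (fine n0 = 0 %[mod 3])%Z
         & ~ (exists c : Fq, b = c ^+ 3)]
       \/ ((3%:E * n1 = 2%:E * n0)%E
           /\ #|[pred t : Fq | root (cubic a b) t]| = 0%N)) ->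
        sgn = [:: 1; 3]%N].
Proof.
case: AB_standard => irr yroot ygen _ _ _ q n1 n0 a b sgn.
pose tf : {rmorphism {poly Fq} -> ratfun Fq} := @FracField.tofrac {poly Fq}.
have tf_inj : injective tf by move=> u v /eqP; rewrite tofrac_eq => /eqP.
have tf_div := @tofrac_div {poly Fq}.
have -> : sgn = signature (cstK tf) F (max_ideal (O_inf tf)).
  by rewrite (max_ideal_inf tf_inj tf_div).
have B0 : B != 0 := B_neq0 irr.
have b0 : b != 0 by rewrite lead_coef_eq0.
have dim3 : \dim {: F} = 3%N := dim_cubic irr yroot ygen.
have sB : (0 < size B)%N by rewrite lt0n size_poly_eq0.
pose lt32 (i j : nat) := i = 0%N \/ (3 * i.-1 < 2 * j)%N.
have lt01 : (3%:E * n1 < 2%:E * n0)%E -> lt32 (size A) (size B).-1 := @deg_lt _ A B B0.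
have eq01 : (3%:E * n1 = 2%:E * n0)%E ->
  A != 0 /\ (3 * (size A).-1 = 2 * (size B).-1)%N := @deg_eq _ A B B0.
have gt01 : (2%:E * n0 < 3%:E * n1)%E ->
  A != 0 /\ (2 * (size B).-1 < 3 * (size A).-1)%N := @deg_gt _ A B B0.
have n0E : fine n0 = (size B).-1 := fine_deg B0.
have n1E : A != 0 -> fine n1 = (size A).-1 := @fine_deg _ A.
have sizeA : A != 0 -> size A = (size A).-1.+1 by rewrite -size_poly_gt0 => /prednK.
have sizeB : size B = (size B).-1.+1 by rewrite prednK.
have tame : (3%:E * n1 < 2%:E * n0)%E -> (fine n0 = 0 %[mod 3])%Z ->
    exists w al be, [/\ <<1%VS; w>>%VS = fullv,
      w ^+ 3 - inF tf F al * w + inF tf F be = 0, al.[0] = 0 & be.[0] = b].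
  move=> /lt01 lt01'; rewrite n0E => /modz3_0[m mE]; rewrite mE in sizeB lt01'.
  have sA : (size A <= 2 * m)%N.
    case: lt01' => [-> //|]; move: (size A) => i; clear; lia.
  have sB' : (size B <= (3 * m).+1)%N by rewrite sizeB.
  have [w [al [be [wgen wroot al0 be0]]]] :=
    depressed_generator tf_inj yroot ygen (leqW sA) sB'.
  exists w, al, be; split=> //; first by rewrite al0 nth_default.
  by rewrite be0 /b lead_coefE mE.
have balanced : (3%:E * n1 = 2%:E * n0)%E ->
    exists w al be, [/\ <<1%VS; w>>%VS = fullv,
      w ^+ 3 - inF tf F al * w + inF tf F be = 0, al.[0] = a & be.[0] = b].
  move=> /eq01[A0 e01].
  have [m [nE mE]] := triple_eq_double e01.
  have sA' : (size A <= (2 * m).+1)%N by rewrite sizeA // nE.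
  have sB' : (size B <= (3 * m).+1)%N by rewrite sizeB mE.
  have [w [al [be [wgen wroot al0 be0]]]] :=
    depressed_generator tf_inj yroot ygen sA' sB'.
  by exists w, al, be; rewrite al0 be0 /a /b !lead_coefE nE mE.
split.
- case=> [[lt n03 [c bE] q1]|[e01 c3]].
    have [w [al [be [wgen wroot al0 be0]]]] := tame lt n03.
    have [rs [urs srs frs]] := pure_cubic_split charFq b0 bE (modz3_1 q1).
    by apply: (signature_split tf_inj tf_div dim3 wgen wroot urs srs); rewrite al0 be0.
  have [w [al [be [wgen wroot al0 be0]]]] := balanced e01.
  apply: (signature_split tf_inj tf_div dim3 wgen wroot (enum_uniq _)).
    by rewrite -cardE; exact: c3.
  by apply/allP => t; rewrite mem_enum inE al0 be0.
- case=> /gt01[A0 lt]; rewrite n1E // => /modz2_1[m mE].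
  have sA : size A = (2 * m).+2 by rewrite sizeA // mE.
  apply: (signature_partial tf_inj tf_div irr yroot ygen sA).
  rewrite sizeB ltnS; move: lt; rewrite mE; move: (size B).-1 => i; clear; lia.
- case=> [[lt n03 [c bE] q2]|[e01 c1]].
    have [w [al [be [wgen wroot al0 be0]]]] := tame lt n03.
    have [fc funique] := pure_cubic_mixed charFq b0 bE (modz3_N1 q2).
    by apply: (signature_mixed tf_inj tf_div dim3 wgen wroot charFq (t := c)); rewrite ?al0 be0.
  have [w [al [be [wgen wroot al0 be0]]]] := balanced e01.
  have /card1P[t ft] : #|[pred t : Fq | root (cubic a b) t]| == 1%N by rewrite c1.
  apply: (signature_mixed tf_inj tf_div dim3 wgen wroot charFq (t := t)); rewrite ?al0 be0 //.
    by have := ft t; rewrite !inE eqxx.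
  by move=> t' ft'; have := ft t'; rewrite !inE ft' => /esym/eqP.
- case=> /lt01 lt; rewrite n0E => /modz3_neq0[m mE].
  case: mE => mE; rewrite mE in sizeB lt.
    apply: (signature_total1 tf_inj tf_div irr yroot ygen _ sizeB).
    by apply: size_bound lt => j; clear; lia.
  apply: (signature_total2 tf_inj tf_div irr yroot ygen _ sizeB).
  by apply: size_bound lt => j; clear; lia.
case=> [[lt n03 nb]|[e01 c0]].
  have [w [al [be [wgen wroot al0 be0]]]] := tame lt n03.
  apply: (signature_inert tf_inj tf_div dim3 wgen wroot); rewrite al0 be0.
  exact: pure_cubic_inert.
have [w [al [be [wgen wroot al0 be0]]]] := balanced e01.
apply: (signature_inert tf_inj tf_div dim3 wgen wroot) => t; rewrite al0 be0.
by have /card0_eq/(_ t) := c0; rewrite !inE => ->.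
Qed.
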